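(* Let $f:\mathbb{R}^{d_1}\times\mathbb{R}^{d_2}\to\mathbb{R}$ be $L$-Lipschitz smooth with $f(x,\cdot)$ $\mu$-strongly concave for every $x$, $L>\mu$, $\kappa=L/\mu$, and $\Delta=\Phi(x_0)-\inf_x\Phi(x)<\infty$. Run the Catalyst algorithm for NC-SC minimax problems (described in the context) with subproblem solver $\mathcal{M}$ equal to the extragradient method (EG) or optimistic gradient descent ascent (OGDA), with $\tau=L-\mu$, $\alpha_0=\frac{\mu^5}{576\max\{1,L^7\}}$, $\alpha_t=\frac{\mu^5}{504L^5}$ for $t>0$, and $\epsilon^t_k=\frac{\sqrt2\mu}{2}(1-\rho)^k\,\mathrm{gap}_{\hat f_t}(x_0^t,y_0^t)$ with $\rho=0.9\sqrt{q}$, $q=\frac{\mu}{\mu+\tau}$. Then the total number of gradient evaluations needed to find an $\epsilon$-stationary point of $\Phi$ is $$\tilde O\left(\sqrt{\kappa}\,L(\Delta+D_y^0)\,\epsilon^{-2}\right),$$ where $D_y^0=\|y_0-y^*(x_0)\|^2$ and $y^*(x_0)=\operatorname{argmax}_{y}f(x_0,y)$.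
   Context: $f$ is $L$-Lipschitz smooth if $\|\nabla_x f(x_1,y_1)-\nabla_x f(x_2,y_2)\|$ and $\|\nabla_y f(x_1,y_1)-\nabla_y f(x_2,y_2)\|$ are at most $L(\|x_1-x_2\|+\|y_1-y_2\|)$ for all arguments. $\Phi(x)=\max_y f(x,y)$. For a function $g(x,y)$, $\mathrm{gap}_g(\bar x,\bar y)=\max_y g(\bar x,y)-\min_x g(x,\bar y)$. A point $\bar x$ is an $\epsilon$-stationary point of $\Phi$ if $\|\nabla\Phi(\bar x)\|\le\epsilon$; for the randomly sampled output $\hat x_T$ this is meant in the sense $\mathbb{E}\|\nabla\Phi(\hat x_T)\|^2\le\epsilon^2$. Catalyst algorithm. Input: $f$, initial point $(x_0,y_0)$, $L$, $\mu$, parameter $\tau>0$, solver $\mathcal{M}$, tolerances $\alpha_t,\epsilon^t_k>0$. Set $(x_0^0,y_0^0)=(x_0,y_0)$, $q=\frac{\mu}{\mu+\tau}$. For $t=0,1,\dots,T$: set $z_1=y_0^t$, $k=1$ and $\hat f_t(x,y)=f(x,y)+L\|x-x_0^t\|^2$. Repeat: using $\mathcal{M}$ started at $(x^t_{k-1},y^t_{k-1})$, find an inexact solution $(x^t_k,y^t_k)$ of $\min_x\max_y\tilde f_{t,k}(x,y)$, where $\tilde f_{t,k}(x,y)=\hat f_t(x,y)-\frac{\tau}{2}\|y-z_k\|^2$, such that $\|\nabla\tilde f_{t,k}(x^t_k,y^t_k)\|^2\le\epsilon^t_k$; set $z_{k+1}=y^t_k+\frac{\sqrt q-q}{\sqrt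 q+q}(y^t_k-y^t_{k-1})$ and increase $k$ by one; until the latest iterate satisfies $\|\nabla\hat f_t(x^t_k,y^t_k)\|^2\le\alpha_t\|\nabla\hat f_t(x^t_0,y^t_0)\|^2$. Set $(x_0^{t+1},y_0^{t+1})$ to be this latest iterate $(x^t_k,y^t_k)$. Output $\hat x_T$ sampled uniformly from $x_0^1,\dots,x_0^T$. Known fact about the solvers used: EG and OGDA (with a constant number of gradient evaluations per iteration), applied to $\min_x\max_y\tilde f_{t,k}$ with solution $(x^*,y^* )$, satisfy $\|x_N-x^*\|^2+\|y_N-y^*\|^2\le(1-1/\Lambda)^N[\|x_0-x^*\|^2+\|y_0-y^*\|^2]$ for their $N$-th iterate $(x_N,y_N)$ from starting point $(x_0,y_0)$, with $\Lambda\ge1$ equal up to a universal constant factor to $\frac{L+\max\{2L,\tau\}}{\min\{L,\mu+\tau\}}$. $\tilde O$ hides universal constants and poly-logarithmic factors in $L,\mu,\kappa$, but no dependence on $\epsilon$.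
   Formalization: L(Δ+D_y^0)ε^{-2} is replaced by max{1, L(Δ+D_y^0)ε^{-2}}, since any run costs at least one evaluation even if Δ+D_y^0=0; EG and OGDA use step θ/(L+max{2L,τ}) with any fixed 0<θ≤1/8, the hidden constant depending on θ. *)

(* Defs.v *)
From HB Require Import structures.
From mathcomp Require Import all_boot all_order all_algebra.
From mathcomp Require Import all_classical all_reals all_analysis.
Set Implicit Arguments.
Unset Strict Implicit.
Unset Printing Implicit Defensive.
Import Order.TTheory GRing.Theory Num.Theory.
Import numFieldNormedType.Exports.
Local Open Scope classical_set_scope.
Local Open Scope ring_scope.

(* The library norm on 'rV[R]_d is the sup norm, so the Euclidean norm is
   introduced here. *)
Definition norm2 (R : realType) (d : nat) (u : 'rV[R]_d) : R :=
  Num.sqrt (\sum_(i < d) u 0 i ^+ 2).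

(* Row of partial derivatives; it is the gradient where g is differentiable. *)
Definition grad (R : realType) (d : nat) (g : 'rV[R]_d -> R) (x : 'rV[R]_d) :
    'rV[R]_d :=
  \row_i 'D_(delta_mx 0 i) g x.

Definition gradx (R : realType) (d1 d2 : nat)
    (g : 'rV[R]_d1 -> 'rV[R]_d2 -> R) (x : 'rV[R]_d1) (y : 'rV[R]_d2) :=
  grad (fun x' => g x' y) x.

Definition grady (R : realType) (d1 d2 : nat)
    (g : 'rV[R]_d1 -> 'rV[R]_d2 -> R) (x : 'rV[R]_d1) (y : 'rV[R]_d2) :=
  grad (g x) y.

Definition sqnorm_grad (R : realType) (d1 d2 : nat)
    (g : 'rV[R]_d1 -> 'rV[R]_d2 -> R) (p : 'rV[R]_d1 * 'rV[R]_d2) : R :=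
  norm2 (gradx g p.1 p.2) ^+ 2 + norm2 (grady g p.1 p.2) ^+ 2.

Definition lipschitz_smooth (R : realType) (d1 d2 : nat) (L : R)
    (f : 'rV[R]_d1 -> 'rV[R]_d2 -> R) : Prop :=
  [/\ forall x y, differentiable (fun x' => f x' y) x,
      forall x y, differentiable (f x) y,
      forall x1 y1 x2 y2, norm2 (gradx f x1 y1 - gradx f x2 y2)
                            <= L * (norm2 (x1 - x2) + norm2 (y1 - y2))
    & forall x1 y1 x2 y2, norm2 (grady f x1 y1 - grady f x2 y2)
                            <= L * (norm2 (x1 - x2) + norm2 (y1 - y2))].

Definition strongly_concave (R : realType) (d : nat) (mu : R)
    (h : 'rV[R]_d -> R) : Prop :=
  forall (u v : 'rV[R]_d) (s : R), 0 <= s <= 1 ->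
    s * h u + (1 - s) * h v + mu / 2 * s * (1 - s) * norm2 (u - v) ^+ 2
      <= h (s *: u + (1 - s) *: v).

(* In phi and gap, sup and inf are attained (hence are max and min) for the
   functions considered: these are strongly concave in y and, in the case of
   gap, strongly convex in x. *)
Definition phi (R : realType) (d1 d2 : nat)
    (f : 'rV[R]_d1 -> 'rV[R]_d2 -> R) (x : 'rV[R]_d1) : R :=
  sup (range (f x)).

Definition gap (R : realType) (d1 d2 : nat)
    (g : 'rV[R]_d1 -> 'rV[R]_d2 -> R) (p : 'rV[R]_d1 * 'rV[R]_d2) : R :=
  sup (range (g p.1)) - inf (range (fun x => g x p.2)).

Definition is_argmax (R : realType) (d : nat) (h : 'rV[R]_d -> R)
    (y : 'rV[R]_d) : Prop := forall y', h y' <= h y.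

Definition fhat (R : realType) (d1 d2 : nat)
    (f : 'rV[R]_d1 -> 'rV[R]_d2 -> R) (L : R) (xc : 'rV[R]_d1) :
    'rV[R]_d1 -> 'rV[R]_d2 -> R :=
  fun x y => f x y + L * norm2 (x - xc) ^+ 2.

Definition ftilde (R : realType) (d1 d2 : nat)
    (f : 'rV[R]_d1 -> 'rV[R]_d2 -> R) (L tau : R) (xc : 'rV[R]_d1)
    (zc : 'rV[R]_d2) : 'rV[R]_d1 -> 'rV[R]_d2 -> R :=
  fun x y => fhat f L xc x y - tau / 2 * norm2 (y - zc) ^+ 2.

Inductive solver := EG | OGDA.

(* The point p - eta F(p') for the saddle operator
   F = (gradient in x, - gradient in y): descent in x and ascent in y. *)
Definition gda_move (R : realType) (d1 d2 : nat)
    (g : 'rV[R]_d1 -> 'rV[R]_d2 -> R) (eta : R)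
    (p p' : 'rV[R]_d1 * 'rV[R]_d2) : 'rV[R]_d1 * 'rV[R]_d2 :=
  (p.1 - eta *: gradx g p'.1 p'.2, p.2 + eta *: grady g p'.1 p'.2).

Definition eg_step (R : realType) (d1 d2 : nat)
    (g : 'rV[R]_d1 -> 'rV[R]_d2 -> R) (eta : R)
    (p : 'rV[R]_d1 * 'rV[R]_d2) : 'rV[R]_d1 * 'rV[R]_d2 :=
  gda_move g eta p (gda_move g eta p p).

(* The state is (current point p_n, previous point p_(n-1)), and
   p_(n+1) = p_n - 2 eta F(p_n) + eta F(p_(n-1)). *)
Definition ogda_step (R : realType) (d1 d2 : nat)
    (g : 'rV[R]_d1 -> 'rV[R]_d2 -> R) (eta : R)
    (s : ('rV[R]_d1 * 'rV[R]_d2) * ('rV[R]_d1 * 'rV[R]_d2)) :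
    ('rV[R]_d1 * 'rV[R]_d2) * ('rV[R]_d1 * 'rV[R]_d2) :=
  (gda_move g (- eta) (gda_move g (2 * eta) s.1 s.1) s.2, s.1).

(* n-th iterate started at p; OGDA starts from p_(-1) = p_0 = p. *)
Definition solver_iter (R : realType) (d1 d2 : nat) (M : solver)
    (g : 'rV[R]_d1 -> 'rV[R]_d2 -> R) (eta : R)
    (p : 'rV[R]_d1 * 'rV[R]_d2) (n : nat) : 'rV[R]_d1 * 'rV[R]_d2 :=
  match M with
  | EG => iter n (eg_step g eta) p
  | OGDA => (iter n (ogda_step g eta) (p, p)).1
  end.

(* Gradient evaluations used by n iterations together with the stopping test
   at each of the iterates 0, ..., n: EG evaluates the gradient at the n + 1
   iterates and at n midpoints, OGDA at the n + 1 iterates. *)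
Definition solver_cost (M : solver) (n : nat) : nat :=
  match M with
  | EG => (2 * n).+1
  | OGDA => n.+1
  end.

Definition first_from (m : nat) (P : nat -> Prop) (n : nat) : Prop :=
  [/\ (m <= n)%N, P n & forall j, (m <= j < n)%N -> ~ P j].

(* Everything computed by the algorithm: pt t k = (x_k^t, y_k^t), zz t k is
   z_k at stage t, iters t k is the number of solver iterations spent on the
   k-th subproblem of stage t, and rounds t is the number of subproblems
   solved at stage t. *)
Record trace (R : realType) (d1 d2 : nat) := Trace {
  pt : nat -> nat -> 'rV[R]_d1 * 'rV[R]_d2;
  zz : nat -> nat -> 'rV[R]_d2;
  iters : nat -> nat -> nat;
  rounds : nat -> nat }.

(* The trace r is that of stages t = 0, ..., T, each of which terminates.
   The solver stops at its first iterate of accuracy tol t k, and a stage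
   stops at the first k >= 1 satisfying its test, so that r is determined up
   to its irrelevant entries.  The test at k of stage t needs no further
   gradient evaluation, the gradients of fhat and ftilde differing by the
   explicit term tau (y - z_k). *)
Definition catalyst_run (R : realType) (d1 d2 : nat)
    (f : 'rV[R]_d1 -> 'rV[R]_d2 -> R) (x0 : 'rV[R]_d1) (y0 : 'rV[R]_d2)
    (L mu tau : R) (M : solver) (eta : R) (alpha : nat -> R)
    (tol : ('rV[R]_d1 * 'rV[R]_d2) -> nat -> R)
    (T : nat) (r : trace R d1 d2) : Prop :=
  let q := mu / (mu + tau) in
  pt r 0 0 = (x0, y0) /\
  forall t, (t <= T)%N ->
    let xc := (pt r t 0).1 in
    [/\ zz r t 1 = (pt r t 0).2,
        forall k, (1 <= k <= rounds r t)%N ->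
          let g := ftilde f L tau xc (zz r t k) in
          [/\ first_from 0
                (fun n => sqnorm_grad g (solver_iter M g eta (pt r t k.-1) n)
                            <= tol (pt r t 0) k)
                (iters r t k),
              pt r t k = solver_iter M g eta (pt r t k.-1) (iters r t k)
            & zz r t k.+1 = (pt r t k).2
                + ((Num.sqrt q - q) / (Num.sqrt q + q))
                    *: ((pt r t k).2 - (pt r t k.-1).2)],
        first_from 1
          (fun k => sqnorm_grad (fhat f L xc) (pt r t k)
                      <= alpha t * sqnorm_grad (fhat f L xc) (pt r t 0))
          (rounds r t)
      & pt r t.+1 0 = pt r t (rounds r t)].

Definition grad_evals (R : realType) (d1 d2 : nat) (M : solver) (T : nat)
    (r : trace R d1 d2) : nat :=
  \sum_(0 <= t < T.+1) \sum_(1 <= k < (rounds r t).+1)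
     solver_cost M (iters r t k).

(* Expectation of X at an index uniformly distributed on {1, ..., T}. *)
Definition unif_mean (R : realType) (T : nat) (X : nat -> R) : R :=
  T%:R^-1 * \sum_(1 <= t < T.+1) X t.

(* eps-stationarity of a point sampled uniformly from xs 1, ..., xs T. *)
Definition stationary_in_mean (R : realType) (d : nat) (g : 'rV[R]_d -> R)
    (eps : R) (T : nat) (xs : nat -> 'rV[R]_d) : Prop :=
  (forall t, (1 <= t <= T)%N -> differentiable g (xs t)) /\
  unif_mean T (fun t => norm2 (grad g (xs t)) ^+ 2) <= eps ^+ 2.

(* Main.v *)
Require Import Defs.
From HB Require Import structures.
From mathcomp Require Import all_boot all_order all_algebra.
From mathcomp Require Import all_classical all_reals all_analysis.
From mathcomp Require Import ring lra.
Import Order.TTheory GRing.Theory Num.Theory.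
Import numFieldNormedType.Exports.
Set Implicit Arguments.
Unset Strict Implicit.
Unset Printing Implicit Defensive.
Local Open Scope classical_set_scope.
Local Open Scope ring_scope.

(** A stage replaces f by the regularization h = f + L |x - xc|^2, which is
    L-strongly convex in x and mu-strongly concave in y, and solves the saddle
    problem of h by an accelerated proximal point method in y: the subproblem
    of a round subtracts (L - mu) / 2 |y - z|^2, so that both of its moduli and,
    up to a numerical factor, its Lipschitz constant are L. Three estimates
    are multiplied.

    Solver iterations per round. The saddle operator of a subproblem is
    L-strongly monotone and 4 L-Lipschitz, so both solvers contract at a rate
    that depends on theta only [solver_rate]. A round starts within a factor of
    order kappa^2 of its tolerance [stage_warm_start], hence takes a number of
    iterations logarithmic in kappa.

    Rounds per stage. Let D(y) = - min_x h(x, y), minimized at ys, and let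
    s = sqrt (mu / L). The output of a round satisfies a strongly convex
    subgradient inequality for D whose error is controlled by the residual
    [prox_inexact]. Nesterov's energy
    D(y_k) - D(ys) + mu / 2 |v_k - ys|^2 then shrinks by the factor 1 - s at each
    round up to an error that pairs the residual with v_k - ys
    [accel_step]; the energy absorbs this error, and tolerances that decrease by
    the factor 1 - 0.9 s leave the rate 1 - 0.9 s [energy_decay]. So the stopping
    test of a stage holds after sqrt(kappa) rounds, up to logarithms
    [stage_decay_rel, stage_stop].

    Stages. The envelope phi is differentiable by Danskin's theorem [grad_phi].
    A stage is an inexact proximal step on phi: phi decreases by L times the
    squared displacement, up to the residual that the stopping test tolerates,
    and the displacement and this residual control the gradient of phi at the
    next point. A potential collects these terms [potential_descent]; it
    telescopes, and alpha_0 is small enough for its initial value to exceed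
    inf phi by at most 2 (Delta + D_y) [initial_potential]. So
    T of order L (Delta + D_y) / eps^2 stages suffice. *)

(** * Euclidean geometry of row vectors *)

Section Euclid.
Context {R : realType} {n : nat}.
Implicit Types (u v w : 'rV[R]_n) (a : R).

Definition dot u v : R := \sum_(i < n) u 0 i * v 0 i.

Lemma dotC u v : dot u v = dot v u.
Proof. by apply: eq_bigr => i _; rewrite mulrC. Qed.

Lemma dotDl u v w : dot (u + v) w = dot u w + dot v w.
Proof. by rewrite -big_split; apply: eq_bigr => i _ /=; rewrite mxE mulrDl. Qed.

Lemma dotZl a u w : dot (a *: u) w = a * dot u w.
Proof. by rewrite big_distrr; apply: eq_bigr => i _ /=; rewrite mxE mulrA. Qed.

Lemma dotNl u w : dot (- u) w = - dot u w.
Proof. by rewrite -scaleN1r dotZl mulN1r. Qed.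

Lemma dotDr u v w : dot w (u + v) = dot w u + dot w v.
Proof. by rewrite dotC dotDl !(dotC _ w). Qed.

Lemma dotZr a u w : dot w (a *: u) = a * dot w u.
Proof. by rewrite dotC dotZl dotC. Qed.

Lemma dotNr u w : dot w (- u) = - dot w u.
Proof. by rewrite dotC dotNl dotC. Qed.

Lemma dot0l w : dot 0 w = 0.
Proof. by rewrite -(scale0r 0) dotZl mul0r. Qed.

Definition dotE := (dotDl, dotDr, dotNl, dotNr, dotZl, dotZr).

Lemma dot_ge0 u : 0 <= dot u u.
Proof. by apply: sumr_ge0 => i _; rewrite -expr2 sqr_ge0. Qed.

Lemma sqr_norm2 u : norm2 u ^+ 2 = dot u u.
Proof.
rewrite /norm2 sqr_sqrtr; first by apply: eq_bigr => i _; rewrite expr2.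
by apply: sumr_ge0 => i _; rewrite sqr_ge0.
Qed.

Lemma norm2_ge0 u : 0 <= norm2 u.
Proof. exact: sqrtr_ge0. Qed.

Lemma norm2_le u a : 0 <= a -> dot u u <= a ^+ 2 -> norm2 u <= a.
Proof.
by move=> a0 h; rewrite -(ler_pXn2r (ltn0Sn 1)) ?nnegrE ?norm2_ge0// sqr_norm2.
Qed.

Lemma le_norm2 u v : (norm2 u <= norm2 v) = (dot u u <= dot v v).
Proof. by rewrite -!sqr_norm2 ler_pXn2r// ?nnegrE norm2_ge0. Qed.

Lemma coord_le u i : `|u 0 i| <= norm2 u.
Proof.
rewrite -(ler_pXn2r (ltn0Sn 1)) ?nnegrE ?norm2_ge0// sqr_norm2 real_normK ?num_real//.
rewrite /dot (bigD1 i)//= -expr2 lerDl.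
by apply: sumr_ge0 => j _; rewrite -expr2 sqr_ge0.
Qed.

Lemma dot_eq0 u : dot u u = 0 -> u = 0.
Proof.
move=> h; apply/rowP => i; rewrite mxE; apply/eqP; rewrite -normr_le0.
by rewrite (le_trans (coord_le u i))// norm2_le// h expr0n.
Qed.

(** Young's inequality; optimizing the weight a gives Cauchy-Schwarz. *)
Lemma dot_young a u v : 0 < a -> dot u v <= a / 2 * dot u u + dot v v / (2 * a).
Proof.
move=> a0; have := dot_ge0 (a *: u - v); rewrite !dotE (dotC v u) => h.
rewrite -(ler_pM2l (_ : 0 < 2 * a)); last lra.
have -> : 2 * a * (a / 2 * dot u u + dot v v / (2 * a))
          = a * (a * dot u u) + dot v v by field; rewrite gt_eqF.
lra.
Qed.

Lemma cauchy_schwarz u v : dot u v <= norm2 u * norm2 v.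
Proof.
have [/eqP u0|u0] := boolP (norm2 u == 0).
  have -> : u = 0 by apply: dot_eq0; rewrite -sqr_norm2 u0 expr0n.
  by rewrite dot0l mulr_ge0 ?norm2_ge0.
have [/eqP v0|v0] := boolP (norm2 v == 0).
  have -> : v = 0 by apply: dot_eq0; rewrite -sqr_norm2 v0 expr0n.
  by rewrite dotC dot0l mulr_ge0 ?norm2_ge0.
have u1 : 0 < norm2 u by rewrite lt_neqAle eq_sym u0 norm2_ge0.
have v1 : 0 < norm2 v by rewrite lt_neqAle eq_sym v0 norm2_ge0.
apply: le_trans (dot_young u v (divr_gt0 v1 u1)) _.
rewrite -!sqr_norm2 le_eqVlt; apply/orP; left; apply/eqP.
by field; rewrite u0 v0.
Qed.

Lemma norm2N u : norm2 (- u) = norm2 u.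
Proof. by apply/eqP; rewrite eq_le !le_norm2 !dotE !opprK lexx. Qed.

Lemma norm2B u v : norm2 (u - v) = norm2 (v - u).
Proof. by rewrite -norm2N opprB. Qed.

Lemma cauchy_schwarz_abs u v : `|dot u v| <= norm2 u * norm2 v.
Proof.
by rewrite ler_norml cauchy_schwarz andbT lerNl -dotNl -(norm2N u) cauchy_schwarz.
Qed.

Lemma norm2_triangle u v : norm2 (u + v) <= norm2 u + norm2 v.
Proof.
apply: norm2_le; first by rewrite addr_ge0 ?norm2_ge0.
rewrite sqrrD !sqr_norm2 !dotE (dotC v u); have := cauchy_schwarz u v; lra.
Qed.

Lemma norm2Z a u : norm2 (a *: u) = `|a| * norm2 u.
Proof.
apply/eqP; rewrite -(eqrXn2 (ltn0Sn 1)) ?mulr_ge0 ?norm2_ge0//.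
by rewrite exprMn !sqr_norm2 !dotE real_normK ?num_real// mulrA expr2.
Qed.

Lemma dot_sqrD u v : dot (u + v) (u + v) <= 2 * dot u u + 2 * dot v v.
Proof. have := dot_ge0 (u - v); rewrite !dotE (dotC v u); lra. Qed.

Lemma norm2_le_mx u : norm2 u <= Num.sqrt n%:R * `|u|.
Proof.
apply: norm2_le; first by rewrite mulr_ge0 ?sqrtr_ge0.
rewrite exprMn sqr_sqrtr ?ler0n// mulr_natl -[n in _ *+ n]card_ord -sumr_const.
apply: ler_sum => i _; rewrite -expr2 -real_normK ?num_real//.
rewrite ler_pXn2r ?nnegrE// [leRHS]/Num.Def.normr/= mx_normrE.
exact: (le_bigmax _ (fun j : 'I_1 * 'I_n => `|u j.1 j.2|) (0, i)).
Qed.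

End Euclid.
(** * Gradients and quadratic bounds *)

Section Calculus.
Context {R : realType} {n : nat}.
Implicit Types (g : 'rV[R]_n -> R) (u v w : 'rV[R]_n).

HB.instance Definition _ w :=
  GRing.isLinear.Build R 'rV[R]_n R _ (dot w)
    (fun a u v => etrans (dotDr (a *: u) v w) (congr1 (+%R^~ _) (dotZr a u w))).

Lemma dot_continuous w : continuous (dot w).
Proof.
apply: bounded_linear_continuous; apply/linear_boundedP.
near=> M => v; apply: le_trans (cauchy_schwarz_abs w v) _.
apply: le_trans (ler_wpM2l (norm2_ge0 w) (norm2_le_mx v)) _.
by rewrite mulrA ler_wpM2r//; near: M; exact: nbhs_pinfty_ge.
Unshelve. all: by end_near. Qed.

Lemma derive_dot g u w : differentiable g u -> 'D_w g u = dot (grad g u) w.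
Proof.
move=> dg; rewrite deriveE// [w in LHS]row_sum_delta linear_sum.
by apply: eq_bigr => i _; rewrite linearZ mxE deriveE// [LHS]mulrC.
Qed.

(** A quadratic error bound identifies the gradient: this serves for quadratic
    penalties as well as for maxima over a parameter. *)
Lemma quad_grad g u w C :
  (forall v, `|g v - g u - dot w (v - u)| <= C * dot (v - u) (v - u)) ->
  differentiable g u /\ grad g u = w.
Proof.
move=> hg.
pose V : normedModType R := 'rV[R]_n.
have ho : (g : V -> R) \o shift (u : V) = cst (g u) + (dot w : V -> R) +o_ (0 : V) id.
  apply/eqaddoP => _/posnumP[e]; near=> h.
  have -> : ((g : V -> R) \o shift (u : V) - (cst (g u) + (dot w : V -> R))) h
            = g (h + u) - g u - dot w h.
    by rewrite /= -[LHS]/(g (h + u) - (g u + dot w h)) opprD addrA.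
  have := hg (h + u); rewrite addrK => /le_trans; apply.
  have /le_trans : C * dot h h <= `|C| * (n%:R * (`|h| * `|h|)).
    apply: (@le_trans _ _ (`|C| * dot h h)).
      by rewrite ler_wpM2r ?dot_ge0 ?ler_norm.
    rewrite ler_wpM2l// -sqr_norm2 -[n%:R]sqr_sqrtr ?ler0n// -expr2 -exprMn.
    by rewrite ler_pXn2r ?nnegrE ?norm2_ge0 ?mulr_ge0 ?sqrtr_ge0 ?norm2_le_mx.
  apply; rewrite !mulrA ler_wpM2r//.
  apply: (@le_trans _ _ ((`|C| * n%:R + 1) * `|h|)).
    by rewrite ler_wpM2r// lerDl.
  rewrite mulrC -ler_pdivlMr; last by rewrite ltr_wpDl// mulr_ge0.
  near: h.
  apply: (@nbhs0_le R V); rewrite divr_gt0// ltr_wpDl// mulr_ge0//.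
have hd := diff_unique (@dot_continuous w) ho.
have dg : differentiable g u.
  by apply/diff_locallyP; rewrite hd; split => //; exact: dot_continuous.
split=> //; apply/rowP => i; rewrite mxE deriveE// hd.
change (dot w (delta_mx 0 i) = w 0 i).
rewrite /dot (bigD1 i)//= big1 ?addr0 ?mxE ?eqxx ?mulr1// => j ji.
by rewrite mxE eqxx (negbTE ji) mulr0.
Unshelve. all: by end_near. Qed.

Lemma is_derive_line g u w t : differentiable g (u + t *: w) ->
  is_derive t 1 (fun s : R => g (u + s *: w)) (dot (grad g (u + t *: w)) w).
Proof.
move=> dg.
have E : (fun h : R => h^-1 *: (((fun s : R => g (u + s *: w)) \o shift t) (h *: 1)
                   - g (u + t *: w)))
       = (fun h => h^-1 *: ((g \o shift (u + t *: w)) (h *: w) - g (u + t *: w))).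
  apply/funext => h /=; congr (_ *: (g _ - _)).
  by rewrite [h *: 1]mulr1 scalerDl addrCA.
split; first by rewrite /derivable E; exact: diff_derivable.
by rewrite /derive E -derive_dot.
Qed.

(** The descent lemma, in both directions. *)
Lemma lipschitz_grad_quad g (l : R) u v :
  (forall x, differentiable g x) ->
  (forall x y, norm2 (grad g x - grad g y) <= l * norm2 (x - y)) ->
  `|g v - g u - dot (grad g u) (v - u)| <= l / 2 * dot (v - u) (v - u).
Proof.
move=> dg lg; set w := v - u.
have key b : exists2 c : R, 0 <= c <= 1 &
    g v - g u = dot (grad g (u + c *: w)) w - 2 * c * b + b.
  pose psi (s : R) : R := g (u + s *: w) - s ^+ 2 * b.
  have dpsi (s : R) : is_derive s 1 psi (dot (grad g (u + s *: w)) w - 2 * s * b).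
    have := is_derive_line (dg (u + s *: w)) => h.
    rewrite /psi; apply: is_derive_eq.
    rewrite scaler0 add0r -[b *: _]/(b * (s * 1 + s * 1)); ring.
  have [c cI hc] : exists2 c, c \in `]0, 1[%R &
      psi 1 - psi 0 = (dot (grad g (u + c *: w)) w - 2 * c * b) * (1 - 0).
    apply: MVT => //.
    apply: continuous_subspaceT => x.
    by apply: differentiable_continuous; apply/derivable1_diffP; case: (dpsi x).
  exists c; first by move: cI; rewrite in_itv /= => /andP[/ltW -> /ltW ->].
  have uw : u + w = v by rewrite /w addrC subrK.
  by move: hc; rewrite /psi scale1r scale0r addr0 uw; lra.
have lip c : 0 <= c <= 1 ->
    `|dot (grad g (u + c *: w)) w - dot (grad g u) w| <= c * (l * dot w w).
  move=> /andP[c0 c1]; rewrite -dotNl -dotDl.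
  apply: le_trans (cauchy_schwarz_abs _ _) _.
  apply: le_trans (ler_wpM2r (norm2_ge0 w) (lg _ _)) _.
  rewrite addrC addKr norm2Z ger0_norm// -sqr_norm2 le_eqVlt; apply/orP; left.
  by apply/eqP; ring.
rewrite ler_norml; apply/andP; split.
  have [c /lip + ->] := key (- (l / 2 * dot w w)).
  rewrite ler_norml => /andP[+ _]; clear.
  move: (dot (grad g _) w) (dot (grad g u) w) (dot w w) => *; lra.
have [c /lip + ->] := key (l / 2 * dot w w).
rewrite ler_norml => /andP[_]; clear.
move: (dot (grad g _) w) (dot (grad g u) w) (dot w w) => *; lra.
Qed.

(** The gradient form of strong concavity: the secant inequality at parameter s
    is compared with the descent lemma and divided by s, and s tends to 0. *)
Lemma strongly_concave_grad g (l mu : R) u v :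
  (forall x, differentiable g x) ->
  (forall x y, norm2 (grad g x - grad g y) <= l * norm2 (x - y)) ->
  strongly_concave mu g ->
  g v <= g u + dot (grad g u) (v - u) - mu / 2 * dot (v - u) (v - u).
Proof.
move=> dg lg cg.
have [w Ew] : exists w, w = v - u by exists (v - u).
rewrite -Ew.
pose B := (`|l| + `|mu|) / 2 * dot w w + 1.
have B0 : 0 < B by rewrite ltr_wpDl// mulr_ge0 ?dot_ge0// divr_ge0// addr_ge0.
have key s : 0 < s <= 1 ->
    g v - (g u + dot (grad g u) w - mu / 2 * dot w w) <= s * B.
  move=> /andP[s0 s1].
  have := cg v u s; rewrite (ltW s0) s1 sqr_norm2 -Ew => /(_ isT) h1.
  have E : s *: v + (1 - s) *: u = u + s *: w.
    by rewrite scalerBl scale1r Ew scalerBr addrCA.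
  have := lipschitz_grad_quad u (u + s *: w) dg lg.
  have -> : u + s *: w - u = s *: w by rewrite addrC addKr.
  rewrite ler_norml !dotE => /andP[_ h2].
  have h3 : (l + mu) / 2 * dot w w <= (`|l| + `|mu|) / 2 * dot w w.
    by rewrite ler_wpM2r ?dot_ge0// ler_pM2r ?invr_gt0// lerD ?ler_norm.
  rewrite -(ler_pM2l s0); move: h1; rewrite E => h1.
  have h4 : s * (s * ((l + mu) / 2 * dot w w)) <= s * (s * B).
    by rewrite !ler_pM2l// (le_trans h3)// lerDl.
  move: h1 h2 h4; clear.
  move: (g (u + s *: w)) (g u) (g v) (dot (grad g u) w) (dot w w) B => *; lra.
rewrite -subr_le0 leNgt; apply/negP => h.
set d := g v - _ in h key.
pose s := Num.min 1 (d / (2 * B)).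
have s0 : 0 < s by rewrite lt_min ltr01 divr_gt0// mulr_gt0.
have /andP[s1 sd] : (s <= 1) && (s <= d / (2 * B)) by rewrite -le_min lexx.
have := key s; rewrite s0 s1 => /(_ isT).
have : s * B <= d / (2 * B) * B by rewrite ler_wpM2r// ltW.
have -> : d / (2 * B) * B = d / 2 by field; rewrite gt_eqF.
lra.
Qed.

End Calculus.
(** * Strongly monotone Lipschitz operators *)

HB.instance Definition _ (R : realType) (m n : nat) := Complete.on 'M[R]_(m, n).

Section Monotone.
Context {R : realType} {n : nat}.
Implicit Types (F : 'rV[R]_n -> 'rV[R]_n) (u v w : 'rV[R]_n) (l m h : R).

Definition lipschitz_op l F := forall u v,
  dot (F u - F v) (F u - F v) <= l ^+ 2 * dot (u - v) (u - v).

Definition strongly_monotone m F := forall u v,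
  m * dot (u - v) (u - v) <= dot (F u - F v) (u - v).

Lemma mx_norm_le u : `|u| <= norm2 u.
Proof.
rewrite [leLHS]/Num.Def.normr/= mx_normrE; apply: bigmax_le; rewrite ?norm2_ge0//.
by move=> [i j] _ /=; rewrite (ord1 i) coord_le.
Qed.

(** Young's inequality with weight m, which leaves half of the monotonicity term. *)
Lemma dist_le_residual m F u v : 0 < m -> strongly_monotone m F -> F v = 0 ->
  dot (u - v) (u - v) <= dot (F u) (F u) / m ^+ 2.
Proof.
move=> m0 mF v0; have := mF u v; rewrite v0 subr0.
have := dot_young (u - v) (F u) m0.
rewrite (dotC (u - v) (F u)) => h1 h2.
have : m / 2 * dot (u - v) (u - v) <= dot (F u) (F u) / (2 * m).
  move: h1 h2; move: (dot _ _) (dot _ _) (_ / (2 * m)) => *; lra.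
rewrite -(ler_pM2l (_ : 0 < 2 / m)) ?divr_gt0// => h.
have -> : dot (u - v) (u - v) = 2 / m * (m / 2 * dot (u - v) (u - v)).
  by field; rewrite gt_eqF.
apply: le_trans h _; rewrite le_eqVlt; apply/orP; left; apply/eqP.
by field; rewrite gt_eqF.
Qed.

(** The explicit step with parameter m / l^2 is a contraction, so its iterates
    form a Cauchy sequence, whose limit is a zero. *)
Lemma monotone_zero l m F : 0 < m -> m <= l ->
  lipschitz_op l F -> strongly_monotone m F -> exists u, F u = 0.
Proof.
move=> m0 ml lF mF; have l0 : 0 < l by apply: lt_le_trans ml.
pose h := m / l ^+ 2; pose T u := u - h *: F u.
pose c := Num.sqrt (1 - m ^+ 2 / l ^+ 2).
have q0 : 0 <= 1 - m ^+ 2 / l ^+ 2.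
  rewrite subr_ge0 ler_pdivrMr ?exprn_gt0// mul1r.
  by rewrite ler_pXn2r// nnegrE ltW.
have c1 : c < 1.
  by rewrite /c -[ltRHS]sqrtr1 ltr_sqrt// ltrBlDr ltrDl divr_gt0// exprn_gt0.
have cT u v : norm2 (T u - T v) <= c * norm2 (u - v).
  apply: norm2_le; first by rewrite mulr_ge0 ?norm2_ge0 ?sqrtr_ge0.
  rewrite exprMn sqr_norm2 (sqr_sqrtr q0).
  have -> : T u - T v = (u - v) - h *: (F u - F v).
    by apply/rowP => i; rewrite !mxE; ring.
  have := lF u v; have := mF u v.
  move: (u - v) (F u - F v) => d e h1 h2.
  rewrite !dotE (dotC d e).
  have h3 : h * (m * dot d d) <= h * dot e d.
    by rewrite ler_wpM2l// /h divr_ge0 ?ltW// exprn_gt0.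
  have h4 : h ^+ 2 * dot e e <= h ^+ 2 * (l ^+ 2 * dot d d).
    by rewrite ler_wpM2l// sqr_ge0.
  have E : (1 - m ^+ 2 / l ^+ 2) * dot d d
           = dot d d - 2 * (h * (m * dot d d)) + h ^+ 2 * (l ^+ 2 * dot d d).
    by rewrite /h; field; rewrite gt_eqF.
  rewrite E; move: h3 h4; clear.
  by move: (dot e e) (dot e d) (dot d d) => *; lra.
pose x k := iter k T 0; pose B := norm2 (x 1%N - x 0%N).
have xS k : norm2 (x k.+1 - x k) <= B * c ^+ k.
  elim: k => [|k IH]; first by rewrite mulr1.
  apply: le_trans (cT _ _) _.
  by rewrite exprS mulrCA ler_wpM2l// sqrtr_ge0.
pose V : completeNormedModType R := 'rV[R]_n.
have cs : cvgn (series (telescope (x : V ^nat))).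
  apply: normed_cvg.
  apply: series_le_cvg (is_cvg_geometric_series (a := B) (z := c) _) => [k|k|k|].
  - exact: normr_ge0.
  - by rewrite mulr_ge0 ?norm2_ge0// exprn_ge0// sqrtr_ge0.
  - exact: (le_trans (mx_norm_le (x k.+1 - x k)) (xS k)).
  - by rewrite ger0_norm ?sqrtr_ge0.
have [U xU] : exists U : V, (x : V ^nat) @ \oo --> U.
  exists (x 0%N + limn (series (telescope (x : V ^nat)))).
  rewrite [X in X @ _](_ : _ = (fun k => x 0%N + series (telescope (x : V ^nat)) k)).
    by apply: cvgD; [exact: cvg_cst | exact: cs].
  by apply/funext => k; rewrite -eq_sum_telescope.
exists U.
have dU k : norm2 (T U - U) <= Num.sqrt n%:R * (`|U - x k| + `|x k.+1 - U|).
  have -> : T U - U = (T U - T (x k)) + (x k.+1 - U) by rewrite addrA subrK.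
  apply: le_trans (norm2_triangle _ _) _; rewrite mulrDr lerD ?norm2_le_mx//.
  apply: le_trans (cT _ _) _.
  apply: le_trans (ler_wpM2r (norm2_ge0 _) (ltW c1)) _.
  by rewrite mul1r norm2_le_mx.
have TU : T U - U = 0.
  apply: dot_eq0; rewrite -sqr_norm2; apply/eqP; rewrite sqrf_eq0.
  rewrite eq_le norm2_ge0 andbT; apply/ler_addgt0Pl => e e0; rewrite addr0.
  pose e' := e / (2 * (Num.sqrt n%:R + 1)).
  have s0 : 0 < 2 * (Num.sqrt n%:R + 1) :> R.
    by rewrite mulr_gt0// ltr_wpDl ?sqrtr_ge0.
  have e'0 : 0 < e' by rewrite divr_gt0.
  have /cvgrPdist_le/(_ _ e'0)[N _ hN] := xU.
  apply: le_trans (dU N) _.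
  have h1 : `|U - x N| <= e' by apply: hN => /=.
  have h2 : `|x N.+1 - U| <= e' by rewrite distrC; apply: hN => /=.
  apply: (@le_trans _ _ ((Num.sqrt n%:R + 1) * (e' + e'))).
    by rewrite ler_pM ?lerD ?sqrtr_ge0// ?addr_ge0// lerDl.
  rewrite le_eqVlt; apply/orP; left; apply/eqP; rewrite /e'.
  by field; rewrite gt_eqF// ltr_wpDl ?sqrtr_ge0.
have : - (h *: F U) = 0 by rewrite -TU /T addrC addKr.
move/eqP; rewrite oppr_eq0 scaler_eq0 => /orP[|/eqP//].
by rewrite gt_eqF// divr_gt0// exprn_gt0.
Qed.

(** Monotonicity is used at the midpoint w = p - h F p. Replacing p by w in the inner product
    with F w costs the cross term of F w and F p, which is half of
    |F w|^2 + |F p|^2 - |F w - F p|^2; the Lipschitz bound on the last square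
    leaves a negative multiple of |F p|^2. *)
Lemma extragradient_contract l m h F p z : 0 < m -> m <= l -> 0 < h ->
  h * l <= 1 / 6 -> lipschitz_op l F -> strongly_monotone m F -> F z = 0 ->
  dot (p - h *: F (p - h *: F p) - z) (p - h *: F (p - h *: F p) - z)
    <= (1 - h * m) * dot (p - z) (p - z).
Proof.
move=> m0 ml h0 hl lF mF z0.
set w := p - h *: F p.
have := lF w p; have := mF w z; rewrite z0 subr0.
have -> : w - p = - (h *: F p) by rewrite /w addrC addKr.
have -> : w - z = (p - z) - h *: F p by rewrite /w addrAC.
have -> : p - h *: F w - z = (p - z) - h *: F w by rewrite addrAC.
move: (p - z) (F p) (F w) => d a b; clear -m0 ml h0 hl.
have := dot_ge0 (d - (2 * h) *: a).
rewrite !dotE (dotC b a) (dotC b d) (dotC a d).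
have a0 := dot_ge0 a; have hm : h * m <= 1 / 6.
  by apply: le_trans hl; rewrite ler_wpM2l// ltW.
have hl2 : (h * l) ^+ 2 <= 1 / 36.
  have -> : 1 / 36 = (1 / 6) ^+ 2 :> R by field.
  by rewrite ler_pXn2r// nnegrE ?mulr_ge0 ?ltW// (lt_le_trans m0).
have p1 : 0 <= (1 - 2 * (h * m) - (h * l) ^+ 2) * (h ^+ 2 * dot a a).
  by rewrite mulr_ge0 ?mulr_ge0 ?sqr_ge0//; lra.
move: p1 a0; move: (dot a a) (dot d d) (dot b b) (dot d a) (dot d b) (dot a b).
move=> aa dd bb da db ab p1 a0 h1 h2 h3.
have := ler_wpM2l (ltW h0) h2.
have := ler_wpM2l (sqr_ge0 h) h3.
have := mulr_ge0 (mulr_ge0 (ltW h0) (ltW m0)) h1.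
move: p1; clear; lra.
Qed.

Definition optimistic_energy F h z q q' :=
  dot (q + h *: F q' - z) (q + h *: F q' - z)
  + 2 * h ^+ 2 * dot (F q - F q') (F q - F q').

(** For the optimistic method the shifted iterate p + h F(p') plays the part of
    the base point of an extragradient step; the squared difference of the two
    last operator values makes up for the delay. *)
Lemma optimistic_contract l m h F p p' z : 0 < m -> m <= l -> 0 < h ->
  h * l <= 1 / 6 -> lipschitz_op l F -> strongly_monotone m F -> F z = 0 ->
  optimistic_energy F h z (p - (2 * h) *: F p + h *: F p') p
    <= (1 - h * m) * optimistic_energy F h z p p'.
Proof.
move=> m0 ml h0 hl lF mF z0; rewrite /optimistic_energy.
set w := p - (2 * h) *: F p + h *: F p'.
have := lF w p; have := mF p z; rewrite z0 subr0.
have [d Ed] : exists d, d = p + h *: F p' - z by exists (p + h *: F p' - z).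
rewrite -Ed.
have -> : w + h *: F p - z = d - h *: F p.
  by rewrite Ed; apply/rowP => i; rewrite !mxE; ring.
have -> : w - p = h *: F p' - (2 * h) *: F p by apply/rowP => i; rewrite !mxE; ring.
have -> : p - z = d - h *: F p' by rewrite Ed addrAC addrK.
move: d {Ed} (F p) (F p') (F w) => d a b c; clear -m0 ml h0 hl.
have := dot_ge0 (d - (2 * h) *: b).
have := dot_ge0 (2 *: (a - b) - b).
have ab0 := dot_ge0 (a - b).
have b0 := dot_ge0 b; have hm : h * m <= 1 / 6.
  by apply: le_trans hl; rewrite ler_wpM2l// ltW.
have hl2 : (h * l) ^+ 2 <= 1 / 36.
  have -> : 1 / 36 = (1 / 6) ^+ 2 :> R by field.
  by rewrite ler_pXn2r// nnegrE ?mulr_ge0 ?ltW// (lt_le_trans m0).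
have p1 : 0 <= (8/9 - 2 * (h * m)) * (h ^+ 2 * dot b b).
  by rewrite mulr_ge0 ?mulr_ge0 ?sqr_ge0//; lra.
have p2 : 0 <= (5/9 - 2 * (h * m)) * (h ^+ 2 * dot (a - b) (a - b)).
  by rewrite mulr_ge0 ?mulr_ge0 ?sqr_ge0//; lra.
have p3 : 0 <= (1 / 36 - (h * l) ^+ 2) *
            (2 * h ^+ 2 * dot (2 *: a - b) (2 *: a - b)).
  by rewrite mulr_ge0 ?mulr_ge0 ?sqr_ge0 ?dot_ge0//; lra.
move: p1 p2 p3 ab0 b0; rewrite !dotE (dotC b a) (dotC b d) (dotC a d) (dotC c a).
move: (dot a a) (dot d d) (dot b b) (dot d a) (dot d b) (dot a b) (dot a c) (dot c c).
move=> aa dd bb da db ab ac cc p1 p2 p3 ab0 b0 h4 h1 h2 h3.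
have := ler_wpM2l (ltW h0) h2.
have := ler_wpM2l (sqr_ge0 h) h3.
have := mulr_ge0 (mulr_ge0 (ltW h0) (ltW m0)) h1.
have := mulr_ge0 (sqr_ge0 h) h4.
move: p1 p2 p3; clear; lra.
Qed.

End Monotone.

(** * Linear convergence of the two solvers *)

Section Solvers.
Context {R : realType} {n : nat}.
Implicit Types (F : 'rV[R]_n -> 'rV[R]_n) (p z : 'rV[R]_n) (l m h : R).

Definition op_iter (M : solver) F h p (k : nat) :=
  match M with
  | EG => iter k (fun q => q - h *: F (q - h *: F q)) p
  | OGDA =>
      (iter k (fun s => (s.1 - (2 * h) *: F s.1 + h *: F s.2, s.1)) (p, p)).1
  end.

(** The bound concerns the residual, which is what stopping tests measure. For
    the optimistic method the energy starts at the shifted point p + h F(p),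
    and h F is the difference of two consecutive base points; this accounts for
    the constant. *)
Lemma solver_rate M l m h F p k : 0 < m -> m <= l -> 0 < h -> h * l <= 1 / 6 ->
  lipschitz_op l F -> strongly_monotone m F ->
  dot (F (op_iter M F h p k)) (F (op_iter M F h p k))
    <= (8 / (h * m) ^+ 2 + 8) * (1 - h * m) ^+ k * dot (F p) (F p).
Proof.
move=> m0 ml h0 hl lF mF.
have [z z0] := monotone_zero m0 ml lF mF.
have l0 : 0 < l by exact: lt_le_trans ml.
have hm0 : 0 < h * m by rewrite mulr_gt0.
have hm1 : h * m <= 1 / 6 by apply: le_trans hl; rewrite ler_wpM2l// ltW.
have r0 : 0 <= 1 - h * m by lra.
have Fp0 := dot_ge0 (F p).
have pz := dist_le_residual p m0 mF z0.
case: M => /=.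
  set x := iter k _ p.
  have xz : dot (x - z) (x - z) <= (1 - h * m) ^+ k * dot (p - z) (p - z).
    rewrite /x {x}; elim: k => [|k IH]; first by rewrite mul1r.
    apply: le_trans (extragradient_contract _ m0 ml h0 hl lF mF z0) _.
    by rewrite exprS -mulrA ler_wpM2l.
  have := lF x z; rewrite z0 subr0 => /le_trans; apply.
  apply: le_trans (ler_wpM2l (sqr_ge0 l) xz) _.
  have c0 : 0 <= (1 - h * m) ^+ k by rewrite exprn_ge0.
  apply: le_trans (ler_wpM2l (sqr_ge0 l) (ler_wpM2l c0 pz)) _.
  have -> : l ^+ 2 * ((1 - h * m) ^+ k * (dot (F p) (F p) / m ^+ 2))
      = (h * l) ^+ 2 / (h * m) ^+ 2 * ((1 - h * m) ^+ k * dot (F p) (F p)).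
    by field; rewrite !gt_eqF.
  rewrite -[leRHS]mulrA ler_wpM2r ?mulr_ge0//.
  have : (h * l) ^+ 2 / (h * m) ^+ 2 <= 8 / (h * m) ^+ 2; last lra.
  rewrite ler_pM2r ?invr_gt0 ?exprn_gt0//.
  have : (h * l) ^+ 2 <= (1 / 6) ^+ 2; last lra.
  by rewrite ler_pXn2r// nnegrE ?mulr_ge0// ltW.
pose S := fun k => iter k (fun s => (s.1 - (2 * h) *: F s.1 + h *: F s.2, s.1)) (p, p).
pose V k := optimistic_energy F h z (S k).1 (S k).2.
have Vc j : V j.+1 <= (1 - h * m) * V j.
  exact: (optimistic_contract _ _ m0 ml h0 hl lF mF z0).
have V0 j : 0 <= V j.
  by rewrite /V /optimistic_energy addr_ge0 ?dot_ge0// mulr_ge0 ?dot_ge0// mulr_ge0// sqr_ge0.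
have Vk : V k <= (1 - h * m) ^+ k * V 0%N.
  elim: (k) => [|j IH]; first by rewrite mul1r.
  by apply: le_trans (Vc _) _; rewrite exprS -mulrA ler_wpM2l.
have Fk : h ^+ 2 * dot (F (S k).1) (F (S k).1) <= 4 * V k.
  have : V k.+1 <= V k.
    by apply: le_trans (Vc k) _; rewrite ler_piMl ?V0//; lra.
  rewrite /V /optimistic_energy /=.
  set a := F (S k).1; set b := F (S k).2.
  have -> : (S k).1 - (2 * h) *: a + h *: b + h *: a - z
            = ((S k).1 + h *: b - z) - h *: a.
    by apply/rowP => i; rewrite !mxE; ring.
  have [d <-] : exists d, d = (S k).1 + h *: b - z by eexists.
  have := dot_ge0 (F ((S k).1 - (2 * h) *: a + h *: b) - a).
  have := dot_ge0 (2 *: d - h *: a); have := dot_ge0 (a - b).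
  move=> /(mulr_ge0 (sqr_ge0 h)) + + /(mulr_ge0 (sqr_ge0 h)).
  move: (dot (a - b) (a - b)) (dot (F _ - a) _); rewrite !dotE (dotC a d).
  move: (dot a a) (dot d a) (dot d d); clear; move=> *; lra.
have h2 : 0 < h ^+ 2 by rewrite exprn_gt0.
rewrite -(ler_pM2l h2); apply: le_trans Fk _.
apply: le_trans (ler_wpM2l _ Vk) _; first lra.
have : V 0%N <= (2 / m ^+ 2 + 2 * h ^+ 2) * dot (F p) (F p).
  rewrite /V /optimistic_energy /= subrr dot0l mulr0 addr0 addrAC.
  apply: le_trans (dot_sqrD _ _) _; rewrite dotZl dotZr; move: pz.
  have -> : dot (F p) (F p) / m ^+ 2 = m ^- 2 * dot (F p) (F p) by rewrite mulrC.
  by move: (m ^- 2) (dot (F p) _) (dot (p - z) _); clear; move=> *; lra.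
have c0 : 0 <= (1 - h * m) ^+ k by rewrite exprn_ge0.
move=> /(ler_wpM2l c0) /(ler_wpM2l (ler0n R 4)) /le_trans; apply.
rewrite le_eqVlt; apply/orP; left; apply/eqP.
by field; rewrite !gt_eqF.
Qed.

End Solvers.

(** * Strongly-convex-strongly-concave saddle functions *)

Section Pairs.
Context {R : realType} {d1 d2 : nat}.
Implicit Types (g : 'rV[R]_d1 -> 'rV[R]_d2 -> R) (p : 'rV[R]_d1 * 'rV[R]_d2).

Definition stack p : 'rV[R]_(d1 + d2) := row_mx p.1 p.2.

(** The saddle operator, whose zeros are the saddle points and along which both
    solvers move. *)
Definition saddle_op g (P : 'rV[R]_(d1 + d2)) : 'rV[R]_(d1 + d2) :=
  row_mx (gradx g (lsubmx P) (rsubmx P)) (- grady g (lsubmx P) (rsubmx P)).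

Lemma saddle_op_stack g p :
  saddle_op g (stack p) = row_mx (gradx g p.1 p.2) (- grady g p.1 p.2).
Proof. by rewrite /saddle_op row_mxKl row_mxKr. Qed.

Lemma dot_row_mx (a c : 'rV[R]_d1) (b d : 'rV[R]_d2) :
  dot (row_mx a b) (row_mx c d) = dot a c + dot b d.
Proof.
rewrite /dot big_split_ord /=.
by congr (_ + _); apply: eq_bigr => i _; rewrite ?row_mxEl ?row_mxEr.
Qed.

Lemma stackB p p' : stack p - stack p' = row_mx (p.1 - p'.1) (p.2 - p'.2).
Proof. by rewrite /stack opp_row_mx add_row_mx. Qed.

Lemma stack_submx (P : 'rV[R]_(d1 + d2)) : stack (lsubmx P, rsubmx P) = P.
Proof. exact: hsubmxK. Qed.

Lemma sqnorm_gradE g p :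
  sqnorm_grad g p = dot (saddle_op g (stack p)) (saddle_op g (stack p)).
Proof.
by rewrite saddle_op_stack dot_row_mx /sqnorm_grad !sqr_norm2 !dotE opprK.
Qed.

Lemma stack_gda_move g h p p' :
  stack (gda_move g h p p') = stack p - h *: saddle_op g (stack p').
Proof.
by rewrite saddle_op_stack /stack scale_row_mx opp_row_mx add_row_mx scalerN opprK.
Qed.

Lemma stack_solver_iter M g h p k :
  stack (solver_iter M g h p k) = op_iter M (saddle_op g) h (stack p) k.
Proof.
case: M => /=.
  by elim: k => //= k IH; rewrite /eg_step !stack_gda_move IH.
pose st (s : ('rV[R]_d1 * 'rV[R]_d2) * ('rV[R]_d1 * 'rV[R]_d2)) :=
  (stack s.1, stack s.2).
suff : st (iter k (ogda_step g h) (p, p)) =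
  iter k (fun s => (s.1 - (2 * h) *: saddle_op g s.1 + h *: saddle_op g s.2, s.1))
    (stack p, stack p) by move=> <-.
elim: k => //= k <-.
by rewrite /st /= /ogda_step /= !stack_gda_move scaleNr opprK.
Qed.

Definition convex_x (mx : R) g := forall x y x',
  g x y + dot (gradx g x y) (x' - x) + mx / 2 * dot (x' - x) (x' - x) <= g x' y.

Definition concave_y (my : R) g := forall x y y',
  g x y' <= g x y + dot (grady g x y) (y' - y) - my / 2 * dot (y' - y) (y' - y).

Section Saddle.
Variables (mx my l : R) (g : 'rV[R]_d1 -> 'rV[R]_d2 -> R).
Hypotheses (mx0 : 0 < mx) (my0 : 0 < my).
Hypotheses (hgx : convex_x mx g) (hgy : concave_y my g).
Hypothesis lg : lipschitz_op l (saddle_op g).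

Lemma saddle_monotone m : m <= mx -> m <= my -> strongly_monotone m (saddle_op g).
Proof.
move=> hx hy P Q; rewrite -(stack_submx P) -(stack_submx Q).
move: (lsubmx P, rsubmx P) (lsubmx Q, rsubmx Q) => p q {P Q}.
rewrite !saddle_op_stack stackB !opp_row_mx !add_row_mx !dot_row_mx.
case: p q => [x y] [x' y'] /=.
have := hgx x y x'; have := hgx x' y' x; have := hgy x y y'; have := hgy x' y' y.
have X0 := ler_wpM2r (dot_ge0 (x - x')) hx.
have Y0 := ler_wpM2r (dot_ge0 (y - y')) hy.
rewrite -(opprB x x') -(opprB y y'); move: (x - x') (y - y') X0 Y0 => a b.
rewrite !dotE !opprK.
move: (dot a a) (dot b b) (dot (gradx g x y) a) (dot (gradx g x' y') a)
  (dot (grady g x y) b) (dot (grady g x' y') b) (g x y) (g x' y) (g x y')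
  (g x' y').
by clear; move=> *; lra.
Qed.

(** Minimizing the lower quadratic model over x' gives the gradient domination
    inequality; it also bounds the range from below, so that the infimum in
    the gap is a genuine one. *)
Lemma min_x_ge x y x' :
  g x y - dot (gradx g x y) (gradx g x y) / (2 * mx) <= g x' y.
Proof.
have := hgx x y x'.
have := dot_young (- (gradx g x y)) (x' - x) (divr_gt0 ltr01 mx0).
rewrite dotNl dotNl dotNr opprK.
have -> : dot (x' - x) (x' - x) / (2 * (1 / mx)) = mx / 2 * dot (x' - x) (x' - x).
  by field; rewrite gt_eqF.
have -> : 1 / mx / 2 * dot (gradx g x y) (gradx g x y)
          = dot (gradx g x y) (gradx g x y) / (2 * mx).
  by field; rewrite gt_eqF.
lra.
Qed.

Lemma max_y_le x y y' :
  g x y' <= g x y + dot (grady g x y) (grady g x y) / (2 * my).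
Proof.
have := hgy x y y'.
have := dot_young (grady g x y) (y' - y) (divr_gt0 ltr01 my0).
have -> : dot (y' - y) (y' - y) / (2 * (1 / my)) = my / 2 * dot (y' - y) (y' - y).
  by field; rewrite gt_eqF.
have -> : 1 / my / 2 * dot (grady g x y) (grady g x y)
          = dot (grady g x y) (grady g x y) / (2 * my).
  by field; rewrite gt_eqF.
lra.
Qed.

Lemma saddle_exists m : 0 < m -> m <= mx -> m <= my -> m <= l ->
  exists p, gradx g p.1 p.2 = 0 /\ grady g p.1 p.2 = 0.
Proof.
move=> m0 hx hy hl.
have [P] := monotone_zero m0 hl lg (saddle_monotone hx hy).
rewrite -(stack_submx P) saddle_op_stack -[0](@hsubmxK _ _ d1 d2).
move/eq_row_mx => [/= h1 h2]; exists (lsubmx P, rsubmx P) => /=.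
rewrite h1 linear0; split=> //.
by apply/eqP; rewrite -oppr_eq0 h2 linear0.
Qed.

Definition min_x (y : 'rV[R]_d2) := inf (range (fun x => g x y)).

Lemma min_x_lbound x y : lbound (range (fun x => g x y))
  (g x y - dot (gradx g x y) (gradx g x y) / (2 * mx)).
Proof. by move=> _ [x' _ <-]; exact: min_x_ge. Qed.

Lemma min_x_le x y : min_x y <= g x y.
Proof.
have hb : has_lbound (range (fun x => g x y)) 
  by exists (g x y - dot (gradx g x y) (gradx g x y) / (2 * mx)); exact: min_x_lbound.
by apply: (ge_inf hb); exists x.
Qed.

Lemma le_min_x x y :
  g x y - dot (gradx g x y) (gradx g x y) / (2 * mx) <= min_x y.
Proof.
by apply: lb_le_inf; [exists (g 0 y); exists 0 | exact: min_x_lbound].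
Qed.

Definition max_y (x : 'rV[R]_d1) := sup (range (g x)).

Lemma max_y_ubound x y : ubound (range (g x))
  (g x y + dot (grady g x y) (grady g x y) / (2 * my)).
Proof. by move=> _ [y' _ <-]; exact: max_y_le. Qed.

Lemma le_max_y x y : g x y <= max_y x.
Proof.
have hb : has_ubound (range (g x)) 
  by exists (g x y + dot (grady g x y) (grady g x y) / (2 * my)); exact: max_y_ubound.
by apply: (ub_le_sup hb); exists y.
Qed.

Lemma max_y_upper x y :
  max_y x <= g x y + dot (grady g x y) (grady g x y) / (2 * my).
Proof.
by apply: ge_sup; [exists (g x 0); exists 0 | exact: max_y_ubound].
Qed.

Lemma gapE p : gap g p = max_y p.1 - min_x p.2.
Proof. by []. Qed.

Lemma gap_le p : gap g p <= dot (gradx g p.1 p.2) (gradx g p.1 p.2) / (2 * mx)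
                        + dot (grady g p.1 p.2) (grady g p.1 p.2) / (2 * my).
Proof.
rewrite gapE; have := max_y_upper p.1 p.2; have := le_min_x p.1 p.2.
move: (max_y _) (min_x _) (g _ _) (_ / _) (_ / _) => *; lra.
Qed.

End Saddle.
End Pairs.

(** * The objective, its regularizations and its envelope *)

Definition nc_sc (R : realType) (d1 d2 : nat) (L mu : R)
    (f : 'rV[R]_d1 -> 'rV[R]_d2 -> R) : Prop :=
  [/\ 0 < mu, mu < L, lipschitz_smooth L f
    & forall x, strongly_concave mu (f x)].

Lemma norm20 (R : realType) d : norm2 (0 : 'rV[R]_d) = 0.
Proof. by apply/eqP; rewrite -sqrf_eq0 sqr_norm2 dot0l. Qed.

Lemma sqr_norm2_shift (R : realType) d (c u v : 'rV[R]_d) :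
  norm2 (v - c) ^+ 2 = norm2 (u - c) ^+ 2 + 2 * dot (u - c) (v - u)
                       + dot (v - u) (v - u).
Proof.
rewrite !sqr_norm2.
have -> : v - c = (u - c) + (v - u) by apply/rowP => i; rewrite !mxE; ring.
by rewrite !(dotDl (u - c)) !(dotDr _ (v - u)) (dotC (v - u) (u - c)); ring.
Qed.

Section Objective.
Context {R : realType} {d1 d2 : nat}.
Variables (f : 'rV[R]_d1 -> 'rV[R]_d2 -> R) (L mu : R).
Hypothesis obj : nc_sc L mu f.

Let mu0 : 0 < mu. Proof. by case: obj. Qed.
Let muL : mu < L. Proof. by case: obj. Qed.
Let hf : lipschitz_smooth L f. Proof. by case: obj. Qed.
Let hc x : strongly_concave mu (f x). Proof. by case: obj. Qed.
Let L0 : 0 < L. Proof. exact: lt_trans muL. Qed.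

Lemma gradx_lipschitz y x x' :
  norm2 (gradx f x y - gradx f x' y) <= L * norm2 (x - x').
Proof. by have [_ _ h _] := hf; have := h x y x' y; rewrite subrr norm20 addr0. Qed.

Lemma grady_lipschitz x y y' :
  norm2 (grady f x y - grady f x y') <= L * norm2 (y - y').
Proof. by have [_ _ _ h] := hf; have := h x y x y'; rewrite subrr norm20 add0r. Qed.

Lemma f_quad_x x y x' : `|f x' y - f x y - dot (gradx f x y) (x' - x)|
  <= L / 2 * dot (x' - x) (x' - x).
Proof.
have [h _ _ _] := hf.
exact: (lipschitz_grad_quad x x' (fun z => h z y) (gradx_lipschitz y)).
Qed.

Lemma f_quad_y x y y' : `|f x y' - f x y - dot (grady f x y) (y' - y)|
  <= L / 2 * dot (y' - y) (y' - y).
Proof.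
have [_ h _ _] := hf.
exact: (lipschitz_grad_quad y y' (h x) (grady_lipschitz x)).
Qed.

Lemma f_concave_y : concave_y mu f.
Proof.
move=> x y y'; have [_ h _ _] := hf.
exact: (strongly_concave_grad y y' (h x) (grady_lipschitz x) (hc x)).
Qed.

(** ** The subproblems, and the stage problem as the case tau = 0 *)

Section Regularized.
Variables (tau : R) (xc : 'rV[R]_d1) (zc : 'rV[R]_d2).
Hypotheses (tau0 : 0 <= tau) (tauL : tau <= L).
Let g := ftilde f L tau xc zc.

Lemma ftilde_x x y x' : g x' y - g x y =
  f x' y - f x y + L * (2 * dot (x - xc) (x' - x) + dot (x' - x) (x' - x)).
Proof. by rewrite /g /ftilde /fhat (sqr_norm2_shift xc x x'); ring. Qed.

Lemma ftilde_y x y y' : g x y' - g x y =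
  f x y' - f x y - tau / 2 * (2 * dot (y - zc) (y' - y) + dot (y' - y) (y' - y)).
Proof. by rewrite /g /ftilde /fhat (sqr_norm2_shift zc y y'); ring. Qed.

Lemma gradx_ftilde x y : gradx g x y = gradx f x y + (2 * L) *: (x - xc).
Proof.
have [] // := @quad_grad _ _ (fun x => g x y) x
  (gradx f x y + (2 * L) *: (x - xc)) (L / 2 + L).
move=> x'; rewrite ftilde_x (dotDl (gradx f x y)) dotZl.
set D := dot (x' - x) (x' - x); have D0 : 0 <= D := dot_ge0 _.
set a := dot (x - xc) _; set c := dot (gradx f x y) _.
have -> : f x' y - f x y + L * (2 * a + D) - (c + 2 * L * a)
          = (f x' y - f x y - c) + L * D by ring.
apply: le_trans (ler_normD _ _) _.
by rewrite (ger0_norm (mulr_ge0 (ltW L0) D0)) mulrDl lerD2r; exact: f_quad_x.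
Qed.

Lemma grady_ftilde x y : grady g x y = grady f x y - tau *: (y - zc).
Proof.
have [] // := @quad_grad _ _ (g x) y (grady f x y - tau *: (y - zc)) (L / 2 + tau / 2).
move=> y'; rewrite ftilde_y (dotDl (grady f x y)) dotNl dotZl.
set D := dot (y' - y) (y' - y); have D0 : 0 <= D := dot_ge0 _.
set a := dot (y - zc) _; set c := dot (grady f x y) _.
have -> : f x y' - f x y - tau / 2 * (2 * a + D) - (c - tau * a)
          = (f x y' - f x y - c) - tau / 2 * D by field.
apply: le_trans (ler_normB _ _) _.
have t0 : 0 <= tau / 2 * D by rewrite mulr_ge0// divr_ge0.
by rewrite (ger0_norm t0) mulrDl lerD2r; exact: f_quad_y.
Qed.

Lemma convex_x_ftilde : convex_x L g.
Proof.
move=> x y x'; have := ftilde_x x y x'; have := f_quad_x x y x'.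
rewrite gradx_ftilde (dotDl (gradx f x y)) dotZl ler_norml => /andP[].
move: (dot _ _) (dot _ _) (dot _ _) (f _ _) (f _ _) (g _ _) (g _ _).
by move=> *; lra.
Qed.

Lemma concave_y_ftilde : concave_y (mu + tau) g.
Proof.
move=> x y y'; have := ftilde_y x y y'; have := f_concave_y x y y'.
rewrite grady_ftilde (dotDl (grady f x y)) dotNl dotZl.
move: (dot _ _) (dot _ _) (dot _ _) (f _ _) (f _ _) (g _ _) (g _ _).
by move=> *; lra.
Qed.

(** If a and b are the norms of the displacements in x and y, the two components
    of the operator move by at most L (3 a + b) and L (a + 2 b). *)
Lemma lipschitz_ftilde : lipschitz_op (4 * L) (saddle_op g).
Proof.
move=> P Q; rewrite -(stack_submx P) -(stack_submx Q).
move: (lsubmx P, rsubmx P) (lsubmx Q, rsubmx Q) => [x y] [x' y'] {P Q}.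
rewrite stackB !saddle_op_stack /= opp_row_mx add_row_mx !dot_row_mx.
rewrite !gradx_ftilde !grady_ftilde.
have [_ _ hx hy] := hf; have := hx x y x' y'; have := hy x y x' y'.
have -> : gradx f x y + (2 * L) *: (x - xc) - (gradx f x' y' + (2 * L) *: (x' - xc))
   = (gradx f x y - gradx f x' y') + (2 * L) *: (x - x').
  by apply/rowP => i; rewrite !mxE; ring.
have -> : - (grady f x y - tau *: (y - zc)) - - (grady f x' y' - tau *: (y' - zc))
   = - (grady f x y - grady f x' y') + tau *: (y - y').
  by apply/rowP => i; rewrite !mxE; ring.
move: (x - x') (y - y') (gradx f x y - _) (grady f x y - _) => a b u v hv hu.
have := norm2_triangle u ((2 * L) *: a).
have := norm2_triangle (- v) (tau *: b).
have Ln := ltW L0; have L2 : 0 <= 2 * L by rewrite mulr_ge0.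
rewrite norm2N !norm2Z (ger0_norm tau0) (ger0_norm L2) => h1 h2.
have a0 := norm2_ge0 a; have b0 := norm2_ge0 b.
have h3 : norm2 (- v + tau *: b) <= L * (norm2 a + 2 * norm2 b).
  have := ler_wpM2r b0 tauL; move: h1 hv; lra.
have h4 : norm2 (u + (2 * L) *: a) <= L * (3 * norm2 a + norm2 b).
  by move: h2 hu; lra.
rewrite -!sqr_norm2.
have h3' : norm2 (- v + tau *: b) ^+ 2 <= (L * (norm2 a + 2 * norm2 b)) ^+ 2.
  by rewrite ler_pXn2r// ?nnegrE ?norm2_ge0// mulr_ge0// addr_ge0// mulr_ge0.
have h4' : norm2 (u + (2 * L) *: a) ^+ 2 <= (L * (3 * norm2 a + norm2 b)) ^+ 2.
  by rewrite ler_pXn2r// ?nnegrE ?norm2_ge0// mulr_ge0// addr_ge0// mulr_ge0.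
apply: le_trans (lerD h4' h3') _; rewrite [X in X + _]exprMn [X in _ + X]exprMn -mulrDr.
have -> : (4 * L) ^+ 2 * (norm2 a ^+ 2 + norm2 b ^+ 2)
          = L ^+ 2 * (16 * (norm2 a ^+ 2 + norm2 b ^+ 2)) by ring.
rewrite ler_wpM2l ?sqr_ge0//.
have := sqr_ge0 (norm2 a - norm2 b); have := mulr_ge0 a0 a0.
have := mulr_ge0 b0 b0; move: (norm2 a) (norm2 b) => *; lra.
Qed.

End Regularized.

Lemma fhatE xc : fhat f L xc = ftilde f L 0 xc 0.
Proof. by apply/funext => x; apply/funext => y; rewrite /ftilde !mul0r subr0. Qed.

Lemma gradx_fhat xc x y : gradx (fhat f L xc) x y = gradx f x y + (2 * L) *: (x - xc).
Proof. by rewrite fhatE gradx_ftilde. Qed.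

Lemma grady_fhat xc x y : grady (fhat f L xc) x y = grady f x y.
Proof. by rewrite fhatE grady_ftilde// scale0r subr0. Qed.

Lemma convex_x_fhat xc : convex_x L (fhat f L xc).
Proof. by rewrite fhatE; exact: convex_x_ftilde. Qed.

Lemma concave_y_fhat xc : concave_y mu (fhat f L xc).
Proof. by rewrite fhatE -[X in concave_y X]addr0; exact: concave_y_ftilde. Qed.

Lemma lipschitz_fhat xc : lipschitz_op (4 * L) (saddle_op (fhat f L xc)).
Proof. by rewrite fhatE; apply: lipschitz_ftilde => //; exact: ltW. Qed.

Lemma grady_monotone x : strongly_monotone mu (fun y => - grady f x y).
Proof.
move=> y y'; have := f_concave_y x y y'; have := f_concave_y x y' y.
rewrite -(opprB y y'); move: (y - y') => b.
rewrite !dotE !opprK; move: (dot _ _) (dot _ _) (dot _ _) (f _ _) (f _ _).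
by move=> *; lra.
Qed.

Lemma argmax_exists x : exists y, grady f x y = 0.
Proof.
have lip : lipschitz_op L (fun y => - grady f x y).
  move=> y y'; rewrite -opprD dotNl dotNr opprK -!sqr_norm2 -exprMn.
  rewrite ler_pXn2r// ?nnegrE ?norm2_ge0//; last by rewrite mulr_ge0 ?norm2_ge0// ltW.
  exact: grady_lipschitz.
have [y /eqP] := monotone_zero mu0 (ltW muL) lip (grady_monotone x).
by rewrite oppr_eq0 => /eqP y0; exists y.
Qed.

Lemma argmax_grady x y : is_argmax (f x) y -> grady f x y = 0.
Proof.
move=> hy; have := hy (y + L^-1 *: grady f x y).
have := f_quad_y x y (y + L^-1 *: grady f x y).
have -> : y + L^-1 *: grady f x y - y = L^-1 *: grady f x y by rewrite addrC addKr.
rewrite ler_norml !dotE => /andP[h1 _] h2.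
have g0 := dot_ge0 (grady f x y).
apply: dot_eq0; apply/eqP; rewrite eq_le g0 andbT.
rewrite -(ler_pM2l (_ : 0 < L^-1 / 2)); last by rewrite divr_gt0 ?invr_gt0.
have E : L / 2 * (L^-1 * (L^-1 * dot (grady f x y) (grady f x y)))
  = L^-1 / 2 * dot (grady f x y) (grady f x y) by field; rewrite gt_eqF.
move: h1 h2; rewrite E; move: (dot _ _) (f _ _) (f _ _) => *; lra.
Qed.

Lemma phi_argmax x y : grady f x y = 0 -> phi f x = f x y.
Proof.
move=> y0; apply/eqP; rewrite eq_le (le_max_y mu0 f_concave_y) andbT.
by have := max_y_upper mu0 f_concave_y x y; rewrite y0 dot0l mul0r addr0.
Qed.

(** The envelope inherits a quadratic upper bound, with the constant of
    smoothness worse by the condition number, because moving x by a step moves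
    the gradient in y at the old maximizer by at most L times that step. *)
Lemma phi_quad x y x' : grady f x y = 0 ->
  `|phi f x' - phi f x - dot (gradx f x y) (x' - x)|
    <= L ^+ 2 / mu * dot (x' - x) (x' - x).
Proof.
move=> y0; rewrite (phi_argmax y0).
have := le_max_y mu0 f_concave_y x' y; have := max_y_upper mu0 f_concave_y x' y.
rewrite -[max_y f x']/(phi f x').
have : dot (grady f x' y) (grady f x' y) <= L ^+ 2 * dot (x' - x) (x' - x).
  have [_ _ _ h] := hf; have := h x' y x y; rewrite y0 subr0 subrr norm20 addr0 => hy.
  rewrite -!sqr_norm2 -exprMn ler_pXn2r// nnegrE ?norm2_ge0//.
  by rewrite mulr_ge0 ?norm2_ge0// ltW.
have := f_quad_x x y x'; rewrite !ler_norml => /andP[].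
have := dot_ge0 (x' - x).
have mi : 0 < mu^-1 by rewrite invr_gt0.
have -> : (2 * mu)^-1 = mu^-1 / 2 by rewrite invfM mulrC.
have : L <= L ^+ 2 / mu.
  by rewrite ler_pdivlMr// expr2 ler_pM2l// ltW.
move: (dot (grady f x' y) (grady f x' y)) (dot (x' - x) (x' - x)).
move: (dot (gradx f x y) (x' - x)) (phi f x') (f x' y) (f x y).
move=> gd P u v gg dd hL d0 h1 h2 h3 h4 h5.
have := mulr_ge0 (ltW L0) d0.
have := ler_wpM2r d0 hL; have := ler_wpM2r (ltW mi) h3.
move: h1 h2 h4 h5 d0 mi; move: (mu^-1) => m *.
by apply/andP; split; lra.
Qed.

Lemma phi_differentiable x : differentiable (phi f) x.
Proof.
have [y y0] := argmax_exists x.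
by have [] := quad_grad (fun x' => phi_quad x' y0).
Qed.

(** Danskin's theorem, read off the quadratic bound at the maximizer. *)
Lemma grad_phi x y : grady f x y = 0 -> grad (phi f) x = gradx f x y.
Proof. by move=> y0; have [] := quad_grad (fun x' => phi_quad x' y0). Qed.

(** The maximizer at x is within |grady f x y| / mu of y by strong monotonicity. *)
Lemma grad_phi_near x y :
  dot (grad (phi f) x - gradx f x y) (grad (phi f) x - gradx f x y)
    <= (L / mu) ^+ 2 * dot (grady f x y) (grady f x y).
Proof.
have [z z0] := argmax_exists x; rewrite (grad_phi z0).
have [_ _ h _] := hf; have := h x z x y; rewrite subrr norm20 add0r => hxy.
have z0' : - grady f x z = 0 by rewrite z0 oppr0.
have := dist_le_residual y mu0 (grady_monotone x) z0'.
rewrite dotNl dotNr opprK => hd.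
apply: (@le_trans _ _ (L ^+ 2 * dot (y - z) (y - z))).
  rewrite -!sqr_norm2 -exprMn ler_pXn2r// ?nnegrE ?norm2_ge0//.
    by rewrite (norm2B y z).
  by rewrite mulr_ge0 ?norm2_ge0// ltW.
apply: le_trans (ler_wpM2l (sqr_ge0 L) hd) _.
rewrite le_eqVlt; apply/orP; left; apply/eqP; field; rewrite gt_eqF//.
Qed.

(** A gradient step of length mu / (2 L^2) on the envelope cannot go below its
    infimum. *)
Lemma grad_phi_le x : has_lbound (range (phi f)) ->
  dot (grad (phi f) x) (grad (phi f) x)
    <= 4 * (L ^+ 2 / mu) * (phi f x - inf (range (phi f))).
Proof.
move=> hb; have [y y0] := argmax_exists x.
set C := L ^+ 2 / mu; have C0 : 0 < C by rewrite divr_gt0 ?exprn_gt0.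
set G := grad (phi f) x.
pose x' := x - (2 * C)^-1 *: G.
have hi : inf (range (phi f)) <= phi f x' by apply: (ge_inf hb); exists x'.
have := phi_quad x' y0; rewrite -(grad_phi y0) -/G -/C.
have -> : x' - x = - ((2 * C)^-1 *: G) by rewrite /x' addrC addKr.
rewrite ler_norml => /andP[_ h]; rewrite !dotE !opprK in h.
have E1 : C * ((2 * C)^-1 * ((2 * C)^-1 * dot G G)) = dot G G / (4 * C).
  by field; rewrite gt_eqF.
have E2 : (2 * C)^-1 * dot G G = 2 * (dot G G / (4 * C)).
  by field; rewrite gt_eqF.
have : dot G G / (4 * C) <= phi f x - inf (range (phi f)).
  move: h hi; rewrite E1 E2; move: (_ / (4 * C)) (phi f x) (phi f x') (inf _).
  by move=> *; lra.
have C4 : 0 < 4 * C by apply: mulr_gt0.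
by move=> hd; rewrite mulrC -ler_pdivrMr.
Qed.

End Objective.

(** * Inexact accelerated proximal point steps *)

Section Acceleration.
Context {R : realType} {d : nat}.
Implicit Types (D : 'rV[R]_d -> R) (r y yp z v vp ys : 'rV[R]_d) (s L mu delta : R).

(** Nesterov's estimate for an inexact proximal step: r is the residual in y and
    delta the error in the value. The hypothesis is used at u = yp with weight
    1 - s and at u = ys with weight s. Up to the factor L / 2, what is left is
    (1 - s) |(1 + s) z - y - s yp|^2 + s (1 - s) |yp - y|^2, and since
    (1 - s) yp + s ys - y = s (ys - v), the residual enters through ys - v. *)
Lemma accel_step D s L delta r yp y z vp v ys :
  0 < s < 1 -> 0 < L ->
  s *: vp = (1 + s) *: z - yp -> s *: v = y - (1 - s) *: yp ->
  (forall u, D y + dot ((L - s ^+ 2 * L) *: (z - y) - r) (u - y)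
             + s ^+ 2 * L / 2 * dot (u - y) (u - y) - delta <= D u) ->
  D y - D ys + s ^+ 2 * L / 2 * dot (v - ys) (v - ys)
    <= (1 - s) * (D yp - D ys + s ^+ 2 * L / 2 * dot (vp - ys) (vp - ys))
       + delta + s * dot r (ys - v).
Proof.
move=> /andP[s0 s1] L0 hvp hv hD.
have Ev : s *: (v - ys) = (y - ys) - (1 - s) *: (yp - ys).
  by rewrite scalerBr hv; apply/rowP => i; rewrite !mxE; ring.
have Evp : s *: (vp - ys) = (1 + s) *: (z - ys) - (yp - ys).
  by rewrite scalerBr hvp; apply/rowP => i; rewrite !mxE; ring.
have E1 : s ^+ 2 * L / 2 * dot (v - ys) (v - ys)
        = L / 2 * dot (s *: (v - ys)) (s *: (v - ys)) by rewrite dotZl dotZr; ring.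
have E2 : s ^+ 2 * L / 2 * dot (vp - ys) (vp - ys)
        = L / 2 * dot (s *: (vp - ys)) (s *: (vp - ys)) by rewrite dotZl dotZr; ring.
have E3 : s * dot r (ys - v) = - dot r (s *: (v - ys)).
  by rewrite -(opprB v ys) dotNr dotZr; ring.
rewrite E1 E2 E3 Ev Evp.
have h1 := ler_wpM2l (_ : 0 <= 1 - s) (hD yp).
have h2 := ler_wpM2l (ltW s0) (hD ys).
have sos := lerD (mulr_ge0 (_ : 0 <= (1 - s))
      (dot_ge0 ((1 + s) *: (z - ys) - (y - ys) - s *: (yp - ys))))
   (mulr_ge0 (_ : 0 <= s * (1 - s)) (dot_ge0 ((yp - ys) - (y - ys)))).
have s1' : 0 <= 1 - s by rewrite subr_ge0 ltW.
move: {h1}(h1 s1') h2 {sos}(ler_wpM2l (ltW L0) (sos s1' (mulr_ge0 (ltW s0) s1'))).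
have -> : yp - y = (yp - ys) - (y - ys) by rewrite opprB addrA subrK.
have -> : ys - y = - (y - ys) by rewrite opprB.
have -> : z - y = (z - ys) - (y - ys) by rewrite opprB addrA subrK.
move: (yp - ys) (y - ys) (z - ys) => a b c.
rewrite !dotE (dotC b a) (dotC c a) (dotC c b).
move: (dot a a) (dot b b) (dot c c) (dot a b) (dot a c) (dot b c) (dot r a) (dot r b).
move: (D y) (D yp) (D ys); clear; move=> *; lra.
Qed.

(** Since the error enters paired with v, the energy itself absorbs it; this
    costs a fraction of the decrease. *)
Lemma accel_energy D s L delta r yp y z vp v ys :
  0 < s < 1 -> 0 < L ->
  s *: vp = (1 + s) *: z - yp -> s *: v = y - (1 - s) *: yp ->
  (forall u, D y + dot ((L - s ^+ 2 * L) *: (z - y) - r) (u - y)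
             + s ^+ 2 * L / 2 * dot (u - y) (u - y) - delta <= D u) ->
  D ys <= D y ->
  (1 - s / 20) * (D y - D ys + s ^+ 2 * L / 2 * dot (v - ys) (v - ys))
    <= (1 - s) * (D yp - D ys + s ^+ 2 * L / 2 * dot (vp - ys) (vp - ys))
       + delta + 10 / (s * L) * dot r r.
Proof.
move=> sI L0 hvp hv hD hys; have /andP[s0 s1] := sI.
have h := accel_step ys sI L0 hvp hv hD.
(* With this weight, Young's inequality spends s / 20 of the energy. *)
have a0 : 0 < 20 / (s ^+ 2 * L) by rewrite divr_gt0// mulr_gt0// exprn_gt0.
have := ler_wpM2l (ltW s0) (dot_young r (ys - v) a0).
have -> : dot (ys - v) (ys - v) = dot (v - ys) (v - ys).
  by rewrite -(opprB v ys) dotNl dotNr opprK.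
have -> : s * (20 / (s ^+ 2 * L) / 2 * dot r r
             + dot (v - ys) (v - ys) / (2 * (20 / (s ^+ 2 * L))))
     = 10 / (s * L) * dot r r + s / 20 * (s ^+ 2 * L / 2 * dot (v - ys) (v - ys)).
  by field; rewrite !gt_eqF.
have := mulr_ge0 (ltW s0) (_ : 0 <= D y - D ys); rewrite subr_ge0 => /(_ hys).
move: h; move: (10 / (s * L) * dot r r) (s * dot r (ys - v)).
move: (s ^+ 2 * L / 2 * dot (v - ys) (v - ys)).
move: (s ^+ 2 * L / 2 * dot (vp - ys) (vp - ys)) (D y) (D yp) (D ys).
by clear; move=> *; lra.
Qed.

End Acceleration.

(** * One stage of the accelerated method *)

Section Stage.
Context {R : realType} {d1 d2 : nat}.
Variables (f : 'rV[R]_d1 -> 'rV[R]_d2 -> R) (L mu s : R) (xc : 'rV[R]_d1).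
Hypothesis obj : nc_sc L mu f.
Hypotheses (sI : 0 < s < 1) (hs : s ^+ 2 * L = mu).
Variables (pt : nat -> 'rV[R]_d1 * 'rV[R]_d2) (zz : nat -> 'rV[R]_d2).

Let h := fhat f L xc.
Let g0 := gap h (pt 0%N).
Let rho := 9 / 10 * s.

Definition stage_tol (k : nat) : R :=
  Num.sqrt 2 * mu / 2 * (1 - 9 / 10 * s) ^+ k * gap (fhat f L xc) (pt 0%N).

(** The first K rounds of a stage, remembering of each round only that its output
    meets the tolerance, whichever solver produced it. *)
Definition prox_run (K : nat) := zz 1%N = (pt 0%N).2 /\
  forall k, (k < K)%N ->
    sqnorm_grad (ftilde f L (L - mu) xc (zz k.+1)) (pt k.+1) <= stage_tol k.+1
    /\ zz k.+2 = (pt k.+1).2 + (1 - s) / (1 + s) *: ((pt k.+1).2 - (pt k).2).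

(* Nesterov's auxiliary sequence, in terms of which the extrapolated point z_(k+1)
   is the combination (y_k + s v_k) / (1 + s) and no y_(k-1) is needed. *)
Let vv k := if k is k'.+1 then (pt k').2 + s^-1 *: ((pt k).2 - (pt k').2)
            else (pt 0%N).2.

Let D (y : 'rV[R]_d2) := - min_x h y.

Let mu0 : 0 < mu. Proof. by case: obj. Qed.
Let muL : mu < L. Proof. by case: obj. Qed.
Let L0 : 0 < L. Proof. exact: lt_trans muL. Qed.
Let s0 : 0 < s. Proof. by case/andP: sI. Qed.
Let s1 : s < 1. Proof. by case/andP: sI. Qed.
Let hgx : convex_x L h := convex_x_fhat obj xc.
Let hgy : concave_y mu h := concave_y_fhat obj xc.

Let zz_vv K k : prox_run K -> (k <= K)%N ->
  s *: vv k = (1 + s) *: zz k.+1 - (pt k).2.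
Proof.
move=> [z1 hr]; case: k => [|k] kK /=.
  by rewrite z1; apply/rowP => i; rewrite !mxE; ring.
have [_ ->] := hr k kK; apply/rowP => i; rewrite !mxE; field.
by rewrite !gt_eqF// addr_gt0.
Qed.

Let vvS k : s *: vv k.+1 = (pt k.+1).2 - (1 - s) *: (pt k).2.
Proof. by apply/rowP => i; rewrite !mxE; field; rewrite gt_eqF. Qed.

Lemma saddle_fhat : exists p, gradx h p.1 p.2 = 0 /\ grady h p.1 p.2 = 0.
Proof.
apply: (saddle_exists hgx hgy (lipschitz_fhat obj xc) mu0) => //.
  exact: ltW.
by apply: le_trans (ltW muL) _; have := L0; lra.
Qed.

Section Saddle.
Variable ps : 'rV[R]_d1 * 'rV[R]_d2.
Hypotheses (psx : gradx h ps.1 ps.2 = 0) (psy : grady h ps.1 ps.2 = 0).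

Let E k := D (pt k).2 - D ps.2 + mu / 2 * dot (vv k - ps.2) (vv k - ps.2).

(** D grows quadratically although it is given only as a marginal function: fix
    x at the saddle point. *)
Lemma dual_growth y : D ps.2 + mu / 2 * dot (y - ps.2) (y - ps.2) <= D y.
Proof.
have := hgy ps.1 ps.2 y; rewrite psy dot0l.
have := min_x_le L0 hgx ps.1 y; have := le_min_x L0 hgx ps.1 ps.2.
rewrite psx dot0l mul0r /D; move: (min_x _ _) (min_x _ _) (h _ _) (h _ _).
by move=> *; lra.
Qed.

Lemma dual_gap y : D y - D ps.2 <= gap h (pt 0%N) + D y - D (pt 0%N).2.
Proof.
rewrite gapE; have := le_max_y mu0 hgy (pt 0%N).1 ps.2.
have := min_x_le L0 hgx (pt 0%N).1 ps.2; rewrite /D.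
by move: (max_y _ _) (min_x _ _) (min_x _ _) (min_x _ _) (h _ _) => *; lra.
Qed.

Lemma gap_growth : mu / 2 * dot (stack (pt 0%N) - stack ps) (stack (pt 0%N) - stack ps)
   <= g0.
Proof.
rewrite stackB dot_row_mx /g0 gapE.
have := le_max_y mu0 hgy (pt 0%N).1 ps.2; have := hgx ps.1 ps.2 (pt 0%N).1.
have := min_x_le L0 hgx ps.1 (pt 0%N).2; have := hgy ps.1 ps.2 (pt 0%N).2.
rewrite psx psy !dot0l.
have := ler_wpM2r (dot_ge0 ((pt 0%N).1 - ps.1)) (ltW muL).
move: (dot ((pt 0%N).1 - ps.1) _) (dot ((pt 0%N).2 - ps.2) _).
by move: (max_y _ _) (min_x _ _) (h _ _) (h _ _) (h _ _) => *; lra.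
Qed.

Lemma g0_ge0 : 0 <= g0.
Proof.
by apply: le_trans gap_growth; rewrite mulr_ge0 ?dot_ge0// divr_ge0// ltW.
Qed.

Lemma rate_gt0 : 1 / 10 < 1 - rho.
Proof. by rewrite /rho; have := s1; lra. Qed.

Let X k := (1 - rho) ^+ k * g0.

Let X0 k : 0 <= X k.
Proof. by rewrite mulr_ge0 ?g0_ge0// exprn_ge0//; have := rate_gt0; lra. Qed.

Let XS k : X k.+1 = (1 - rho) * X k.
Proof. by rewrite /X exprS mulrA. Qed.

Let stage_tolE k : stage_tol k = Num.sqrt 2 * (mu / 2 * X k).
Proof. by rewrite /stage_tol -/rho -/h -/g0 /X; ring. Qed.

Lemma stage_tol_le k : stage_tol k <= 3 / 4 * mu * X k.
Proof.
have h2 : Num.sqrt 2 <= 3 / 2 :> R.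
  have h3 : 0 <= 3 / 2 :> R by lra.
  rewrite -(ler_pXn2r (ltn0Sn 1)) ?nnegrE ?sqrtr_ge0// sqr_sqrtr ?ler0n//.
  by rewrite expr2; lra.
rewrite stage_tolE; have hm : 0 <= mu / 2 * X k by rewrite mulr_ge0 ?X0// divr_ge0// ltW.
by have := ler_wpM2r hm h2; move: (Num.sqrt 2 * _) => *; lra.
Qed.

Lemma stage_tol_ge k : mu / 2 * X k <= stage_tol k.
Proof.
rewrite stage_tolE ler_peMl//; first by rewrite mulr_ge0 ?X0// divr_ge0// ltW.
by rewrite -[leLHS]sqrtr1 ler_sqrt// ler1n.
Qed.

(** The value of h at p.1 bounds D from below everywhere, and at p.2 it bounds D
    from above up to the squared residual in x; concavity in y does the rest. *)
Lemma prox_inexact p z u :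
  D p.2 + dot ((L - mu) *: (z - p.2)
               - grady (ftilde f L (L - mu) xc z) p.1 p.2) (u - p.2)
   + mu / 2 * dot (u - p.2) (u - p.2)
   - dot (gradx (ftilde f L (L - mu) xc z) p.1 p.2)
         (gradx (ftilde f L (L - mu) xc z) p.1 p.2) / (2 * L) <= D u.
Proof.
have t0 : 0 <= L - mu by rewrite subr_ge0 ltW.
rewrite (grady_ftilde obj)// (gradx_ftilde obj) -(gradx_fhat obj xc p.1 p.2).
have -> : (L - mu) *: (z - p.2) - (grady f p.1 p.2 - (L - mu) *: (p.2 - z))
          = - grady h p.1 p.2.
  by rewrite /h (grady_fhat obj); apply/rowP => i; rewrite !mxE; ring.
have := min_x_le L0 hgx p.1 u; have := hgy p.1 p.2 u.
have := le_min_x L0 hgx p.1 p.2; rewrite dotNl /D -/h.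
move: (dot (gradx _ _ _) _ / _) (dot (grady _ _ _) _) (dot (u - _) _).
by move: (min_x _ _) (min_x _ _) (h _ _) (h _ _) => *; lra.
Qed.

(** The slack between the contraction (1 - s) / (1 - s / 20) and the rate
    1 - 9 s / 10 is of order s, as is the error that a tolerance adds, and
    160 exceeds the ratio of the latter to the former. *)
Lemma energy_decay K k : prox_run K -> (k <= K)%N -> E k <= 160 * X k.
Proof.
move=> hr; elim: k => [_|k IH kK].
  rewrite /E /= /X mul1r.
  have := dual_growth (pt 0%N).2; have := dual_gap (pt 0%N).2; have := g0_ge0.
  rewrite -/g0; move: (dot _ _) (D _) (D _) => *; lra.
have {}IH := IH (ltnW kK); have [hsq hz] := hr.2 k kK.
set g := ftilde f L (L - mu) xc (zz k.+1) in hsq.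
have hin := prox_inexact (pt k.+1) (zz k.+1); rewrite -/g in hin.
have := @accel_energy _ _ D s L _ _ (pt k).2 (pt k.+1).2 (zz k.+1) (vv k)
  (vv k.+1) ps.2 sI L0 (zz_vv hr (ltnW kK)) (vvS k).
rewrite hs => /(_ _ _ hin).
have Dy : D ps.2 <= D (pt k.+1).2.
  apply: le_trans (dual_growth _); rewrite lerDl.
  by rewrite mulr_ge0 ?dot_ge0// divr_ge0// ltW.
move=> /(_ Dy); rewrite -/(E k.+1) -/(E k).
have hX := X0 k; have := le_trans hsq (stage_tol_le k.+1).
rewrite /sqnorm_grad !sqr_norm2 XS.
have sL0 : 0 < s * L by rewrite mulr_gt0.
have i0 : 0 <= 10 / (s * L) by rewrite divr_ge0// ltW.
move=> /(ler_wpM2l i0).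
have -> : 10 / (s * L) * (3 / 4 * mu * ((1 - rho) * X k))
          = 15 / 2 * s * ((1 - rho) * X k).
  by rewrite -hs; field; rewrite !gt_eqF.
have A0 := dot_ge0 (gradx g (pt k.+1).1 (pt k.+1).2).
have : dot (gradx g (pt k.+1).1 (pt k.+1).2) (gradx g (pt k.+1).1 (pt k.+1).2)
       / (2 * L) <= 10 / (s * L) * dot (gradx g (pt k.+1).1 (pt k.+1).2)
                                    (gradx g (pt k.+1).1 (pt k.+1).2).
  rewrite mulrC ler_wpM2r// ler_pdivlMr// mulrC.
  have -> : s * L / (2 * L) = s / 2 by field; rewrite gt_eqF.
  by have := s1; lra.
move: (dot (gradx _ _ _) _) (dot (grady _ _ _) _) A0.
move=> A B A0 h1; rewrite mulrDr => h2 h3.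
have sp : 0 < 1 - s / 20 by have := s1; lra.
rewrite -(ler_pM2l sp).
have s1' : 0 <= 1 - s by rewrite subr_ge0 ltW.
have h4 := ler_wpM2l s1' IH.
have h6 := mulr_ge0 (ltW s0) hX; have h5 := mulr_ge0 (ltW s0) h6.
move: h1 h2 h3 h4 h5 h6; rewrite /rho.
move: (E k.+1) (E k) (X k) (10 / (s * L) * A) (10 / (s * L) * B) (A / (2 * L)) => *; lra.
Qed.

Let dist_le K k y : prox_run K -> (k <= K)%N ->
  D ps.2 + mu / 2 * dot (y - ps.2) (y - ps.2) <= D ps.2 + E k ->
  mu * dot (y - ps.2) (y - ps.2) <= 320 * X k.
Proof.
by move=> hr kK; have := energy_decay hr kK; move: (dot _ _) (E k) => *; lra.
Qed.

Let y_dist K k : prox_run K -> (k <= K)%N ->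
  mu * dot ((pt k).2 - ps.2) ((pt k).2 - ps.2) <= 320 * X k.
Proof.
move=> hr kK; apply: (dist_le hr kK); apply: le_trans (dual_growth _) _.
rewrite /E addrA addrCA addrN addr0 lerDl.
by rewrite mulr_ge0 ?dot_ge0// divr_ge0// ltW.
Qed.

Let v_dist K k : prox_run K -> (k <= K)%N ->
  mu * dot (vv k - ps.2) (vv k - ps.2) <= 320 * X k.
Proof.
move=> hr kK; apply: (dist_le hr kK); rewrite /E lerD2l lerDr subr_ge0.
apply: le_trans (dual_growth _); rewrite lerDl.
by rewrite mulr_ge0 ?dot_ge0// divr_ge0// ltW.
Qed.

Let z_dist K k : prox_run K -> (k <= K)%N ->
  mu * dot (zz k.+1 - ps.2) (zz k.+1 - ps.2) <= 320 * X k.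
Proof.
move=> hr kK; have := y_dist hr kK; have := v_dist hr kK.
have : (1 + s) *: (zz k.+1 - ps.2) = ((pt k).2 - ps.2) + s *: (vv k - ps.2).
  by rewrite [s *: (_ - _)]scalerBr (zz_vv hr kK); apply/rowP => i; rewrite !mxE; ring.
move: (zz _ - _) (vv _ - _) ((pt k).2 - _) => z v y ezvy hv hy.
have s10 : 0 < 1 + s by rewrite addr_gt0.
have s2 : 0 < (1 + s) ^+ 2 by rewrite exprn_gt0.
have ez : (1 + s) ^+ 2 * dot z z = dot ((1 + s) *: z) ((1 + s) *: z).
  by rewrite !dotE; ring.
have : dot ((1 + s) *: z) ((1 + s) *: z) <= (1 + s) * (dot y y + s * dot v v).
  rewrite ezvy; have := mulr_ge0 (ltW s0) (dot_ge0 (y - v)).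
  by rewrite !dotE (dotC v y); move: (dot y y) (dot v v) (dot y v) => *; lra.
rewrite -ez => /(ler_wpM2l (ltW mu0)) hz.
rewrite -(ler_pM2l s2).
have h1 := ler_wpM2l (ltW s10) hy.
have h2 := ler_wpM2l (ltW s10) (ler_wpM2l (ltW s0) hv).
move: hz h1 h2; move: (dot z z) (dot y y) (dot v v) (X k) => *; lra.
Qed.

Let dot_sqrB_ps (a b : 'rV[R]_d2) :
  dot (a - b) (a - b) <= 2 * dot (a - ps.2) (a - ps.2) + 2 * dot (b - ps.2) (b - ps.2).
Proof.
have -> : a - b = (a - ps.2) + - (b - ps.2) by rewrite opprB addrA subrK.
apply: le_trans (dot_sqrD _ _) _.
by rewrite dotNl dotNr opprK.
Qed.

Let W := L ^+ 2 / mu.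

Let Wmu : mu * W = L ^+ 2.
Proof. by rewrite /W mulrCA divff ?mulr1// gt_eqF. Qed.

Let muW : mu <= W.
Proof. by rewrite ler_pdivlMr// expr2 ler_pM// ltW. Qed.

(** The gradient of h differs from that of the subproblem by (L - mu) (y_k - z_k),
    and both y_k and z_k are close to ps.2 by the energy bound; at k = 0 the bound
    comes from the gap directly. *)
Lemma stage_decay K k : prox_run K -> (k <= K)%N ->
  sqnorm_grad h (pt k) <= 10 ^+ 5 * (W * X k).
Proof.
move=> hr; case: k => [_|k kK].
  rewrite sqnorm_gradE.
  have F0 : saddle_op h (stack ps) = 0.
    by rewrite saddle_op_stack psx psy oppr0 row_mx0.
  have := lipschitz_fhat obj xc (stack (pt 0%N)) (stack ps).
  rewrite -/h F0 subr0 => /le_trans; apply.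
  rewrite /X mul1r; have := gap_growth; rewrite exprMn.
  have W0 : 0 <= W by rewrite divr_ge0 ?sqr_ge0// ltW.
  move=> /(ler_wpM2l W0); rewrite -Wmu; have := mulr_ge0 W0 g0_ge0.
  move: (dot _ _) W g0 => *; lra.
have [hsq _] := hr.2 k kK.
have := le_trans hsq (stage_tol_le k.+1).
have t0 : 0 <= L - mu by rewrite subr_ge0 ltW.
rewrite /sqnorm_grad !sqr_norm2 (grady_ftilde obj)// (gradx_ftilde obj).
rewrite /h (gradx_fhat obj) (grady_fhat obj).
set u := gradx f _ _ + _; set v := grady f _ _.
set w := (L - mu) *: ((pt k.+1).2 - zz k.+1).
have := dot_sqrD (v - w) w; rewrite subrK.
have hw : dot w w <= L ^+ 2 * dot ((pt k.+1).2 - zz k.+1) ((pt k.+1).2 - zz k.+1).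
  rewrite /w dotZl dotZr mulrA -expr2 ler_wpM2r ?dot_ge0//.
  by rewrite ler_pXn2r ?nnegrE//; [have := mu0; lra | exact: ltW].
have := ler_wpM2l (ltW mu0) (dot_sqrB_ps (pt k.+1).2 (zz k.+1)).
have := y_dist hr kK; have := z_dist hr (ltnW kK).
have := X0 k; have := X0 k.+1.
have : X k <= 10 * X k.+1.
  rewrite XS; have := ler_wpM2r (X0 k) (ltW rate_gt0).
  by move: (_ * X k) => *; lra.
have W0 : 0 <= W by rewrite divr_ge0 ?sqr_ge0// ltW.
move: hw (dot_ge0 u); rewrite -Wmu.
move: (dot ((pt k.+1).2 - zz k.+1) ((pt k.+1).2 - zz k.+1))
  (dot (zz k.+1 - ps.2) (zz k.+1 - ps.2))
  (dot ((pt k.+1).2 - ps.2) ((pt k.+1).2 - ps.2)).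
move: (dot w w) (dot u u) (dot v v) (dot (v - w) _) (X k) (X k.+1).
move=> ww uu vv' vw x x' d dz dy hw u0 xx x'0 x0 hz hy hd hv htol.
have h1 : mu * d <= 10 ^+ 4 * x' by lra.
have h2 := ler_wpM2l W0 h1.
have h3 := ler_wpM2r x'0 muW.
have h4 := mulr_ge0 W0 x'0.
by lra.
Qed.

(** The previous output almost solves the next subproblem, as the tolerances
    decrease by a bounded factor per round; both sides vanish when the stage
    starts at its saddle point. *)
Lemma stage_warm_start K k : prox_run K -> (k <= K)%N ->
  sqnorm_grad (ftilde f L (L - mu) xc (zz k.+1)) (pt k)
    <= 10 ^+ 7 * ((L / mu) ^+ 2 * stage_tol k.+1).
Proof.
move=> hr kK; have := stage_decay hr kK.
have t0 : 0 <= L - mu by rewrite subr_ge0 ltW.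
rewrite /sqnorm_grad !sqr_norm2 (grady_ftilde obj)// (gradx_ftilde obj).
rewrite /h (gradx_fhat obj) (grady_fhat obj).
set u := gradx f _ _ + _; set v := grady f _ _.
set w := (L - mu) *: ((pt k).2 - zz k.+1).
have := dot_sqrD v (- w); rewrite (dotNl w) dotNr opprK.
have hw : dot w w <= L ^+ 2 * dot ((pt k).2 - zz k.+1) ((pt k).2 - zz k.+1).
  rewrite /w dotZl dotZr mulrA -expr2 ler_wpM2r ?dot_ge0//.
  by rewrite ler_pXn2r ?nnegrE//; [have := mu0; lra | exact: ltW].
have := ler_wpM2l (ltW mu0) (dot_sqrB_ps (pt k).2 (zz k.+1)).
have := y_dist hr kK; have := z_dist hr kK.
have : X k <= 10 * X k.+1.
  rewrite XS; have := ler_wpM2r (X0 k) (ltW rate_gt0).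
  by move: (_ * X k) => *; lra.
have := stage_tol_ge k.+1.
have W0 : 0 <= W by rewrite divr_ge0 ?sqr_ge0// ltW.
have -> : (L / mu) ^+ 2 = W / mu by rewrite /W; field; rewrite gt_eqF.
have m0 : 0 <= W / mu by rewrite divr_ge0// ltW.
move=> /(ler_wpM2l m0).
have -> : W / mu * (mu / 2 * X k.+1) = W * X k.+1 / 2 by field; rewrite gt_eqF.
have := X0 k.+1; have := dot_ge0 u; move: hw; rewrite -Wmu.
move: (W / mu * _) => T.
move: (dot ((pt k).2 - zz k.+1) ((pt k).2 - zz k.+1)) (dot (zz k.+1 - ps.2) (zz k.+1 - ps.2))
  (dot ((pt k).2 - ps.2) ((pt k).2 - ps.2)).
move: (dot w w) (dot u u) (dot v v) (dot (v - w) _) (X k) (X k.+1).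
move=> ww uu vv' vw x x' d dz dy hw u0 x'0 hT xx hz hy hd hv hdec.
have h1 : mu * d <= 10 ^+ 5 * x' by lra.
have h2 := ler_wpM2l W0 h1.
have h3 := ler_wpM2l W0 xx.
have h4 := mulr_ge0 W0 x'0.
by lra.
Qed.

Lemma stage_decay_rel K k : prox_run K -> (k <= K)%N ->
  sqnorm_grad h (pt k)
    <= 10 ^+ 5 * ((L / mu) ^+ 2 * ((1 - rho) ^+ k * sqnorm_grad h (pt 0%N))).
Proof.
move=> hr kK; apply: le_trans (stage_decay hr kK) _.
rewrite ler_wpM2l ?exprn_ge0//.
have W0 : 0 <= W by rewrite divr_ge0 ?sqr_ge0// ltW.
have -> : (L / mu) ^+ 2 * ((1 - rho) ^+ k * sqnorm_grad h (pt 0%N))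
          = W * ((1 - rho) ^+ k * (sqnorm_grad h (pt 0%N) / mu)).
  by rewrite /W; field; rewrite gt_eqF.
rewrite ler_wpM2l// ler_wpM2l//.
  by rewrite exprn_ge0//; have := rate_gt0; lra.
apply: le_trans (gap_le L0 mu0 hgx hgy _) _.
rewrite /sqnorm_grad !sqr_norm2 [leRHS]mulrDl.
have := dot_ge0 (gradx h (pt 0%N).1 (pt 0%N).2).
have := dot_ge0 (grady h (pt 0%N).1 (pt 0%N).2).
move: (dot _ _) (dot _ _) => B A B0 A0.
apply: lerD; rewrite ler_wpM2l// lef_pV2 ?posrE ?mulr_gt0//.
  by have := L0; have := muL; lra.
by have := mu0; lra.
Qed.

End Saddle.
End Stage.

(** * Descent of the envelope over the stages *)

Section Outer.
Context {R : realType} {d1 d2 : nat}.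
Variables (f : 'rV[R]_d1 -> 'rV[R]_d2 -> R) (L mu : R).
Hypothesis obj : nc_sc L mu f.
Implicit Types p : 'rV[R]_d1 * 'rV[R]_d2.

Let mu0 : 0 < mu. Proof. by case: obj. Qed.
Let muL : mu < L. Proof. by case: obj. Qed.
Let L0 : 0 < L. Proof. exact: lt_trans muL. Qed.

Lemma sqnorm_fhat_center p : sqnorm_grad (fhat f L p.1) p = sqnorm_grad f p.
Proof.
by rewrite /sqnorm_grad (gradx_fhat obj) (grady_fhat obj) subrr scaler0 addr0.
Qed.

(** The regularized value at p' is compared with that at (p.1, p'.2) by gradient
    domination in x, and the former with the envelope by gradient domination
    in y. *)
Lemma stage_descent p p' :
  phi f p'.1 + L * dot (p'.1 - p.1) (p'.1 - p.1)
    <= phi f p.1 + sqnorm_grad (fhat f L p.1) p' / (2 * mu).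
Proof.
rewrite /sqnorm_grad !sqr_norm2 /=.
have := max_y_upper mu0 (f_concave_y obj) p'.1 p'.2.
have := le_max_y mu0 (f_concave_y obj) p.1 p'.2.
rewrite -[max_y f p'.1]/(phi f p'.1) -[max_y f p.1]/(phi f p.1).
have := min_x_ge L0 (convex_x_fhat obj p.1) p'.1 p'.2 p.1.
rewrite {1 4}/fhat subrr norm20 expr0n mulr0 addr0 sqr_norm2 (grady_fhat obj).
set A := dot (gradx _ _ _) _; set B := dot (grady _ _ _) _.
have : A / (2 * L) <= A / (2 * mu).
  by rewrite ler_wpM2l ?dot_ge0// lef_pV2 ?posrE ?mulr_gt0// ler_pM2l// ltW.
rewrite (mulrDl A B); move: (A / (2 * L)) (A / (2 * mu)) (B / (2 * mu)).
move: (phi f p.1) (phi f p'.1) (f p.1 p'.2) (f p'.1 p'.2) (L * _) => *; lra.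
Qed.

Lemma sqnorm_next p p' : sqnorm_grad f p' <=
  2 * sqnorm_grad (fhat f L p.1) p' + 8 * (L ^+ 2 * dot (p'.1 - p.1) (p'.1 - p.1)).
Proof.
rewrite /sqnorm_grad !sqr_norm2 (gradx_fhat obj) (grady_fhat obj).
have := dot_sqrD (gradx f p'.1 p'.2 + (2 * L) *: (p'.1 - p.1)) (- ((2 * L) *: (p'.1 - p.1))).
rewrite addrK; set b := gradx f _ _ + _; set c := p'.1 - p.1.
rewrite dotNl dotNr opprK dotZl dotZr.
move: (dot b b) (dot c c) (dot_ge0 (grady f p'.1 p'.2)).
move: (dot (grady f p'.1 p'.2) (grady f p'.1 p'.2)).
move: (dot (gradx f p'.1 p'.2) (gradx f p'.1 p'.2)) => *; lra.
Qed.

Lemma grad_phi_next p p' :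
  dot (grad (phi f) p'.1) (grad (phi f) p'.1) <=
  3 * ((L / mu) ^+ 2 * sqnorm_grad (fhat f L p.1) p')
  + 12 * (L ^+ 2 * dot (p'.1 - p.1) (p'.1 - p.1)).
Proof.
have ha := grad_phi_near obj p'.1 p'.2.
rewrite /sqnorm_grad !sqr_norm2 (gradx_fhat obj) (grady_fhat obj).
have -> : grad (phi f) p'.1 = (grad (phi f) p'.1 - gradx f p'.1 p'.2)
  + ((gradx f p'.1 p'.2 + (2 * L) *: (p'.1 - p.1)) - (2 * L) *: (p'.1 - p.1)).
  by rewrite addrK subrK.
set a := grad (phi f) _ - _ in ha *; set b := gradx f _ _ + _; set c := _ *: (_ - _).
have k1 : 1 <= (L / mu) ^+ 2.
  by rewrite -(expr1n _ 2) ler_pXn2r ?nnegrE ?divr_ge0 ?ler_pdivlMr ?mul1r// ltW.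
have := ler_wpM2r (dot_ge0 b) k1.
have -> : 12 * (L ^+ 2 * dot (p'.1 - p.1) (p'.1 - p.1)) = 3 * dot c c.
  by rewrite /c dotZl dotZr; ring.
have := dot_ge0 (a - b); have := dot_ge0 (a + c); have := dot_ge0 (b + c).
move: a b c ha => a b c; rewrite !dotE (dotC b a) (dotC c a) (dotC c b).
move: (dot a a) (dot b b) (dot c c) (dot a b) (dot a c) (dot b c) (dot (grady _ _ _) _).
by move: ((L / mu) ^+ 2) => *; lra.
Qed.

(** The potential of a stage is the envelope plus a multiple of the squared
    gradient that the stopping test leaves over. The multiple, proportional to the
    condition number, pays for the gradients in y; the displacement in x pays
    for the rest. *)
Lemma potential_descent p p' w a' : a' * (L / mu) ^+ 2 <= 1 / 504 ->
  0 <= a' -> 0 <= w -> sqnorm_grad (fhat f L p.1) p' <= w ->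
  dot (grad (phi f) p'.1) (grad (phi f) p'.1) / (24 * L)
  + (phi f p'.1 + L / mu ^+ 2 * (a' * sqnorm_grad f p'))
  <= phi f p.1 + L / mu ^+ 2 * w.
Proof.
move=> ha a0 w0 hw.
have h1 := stage_descent p p'; have h2 := sqnorm_next p p'.
have h3 := grad_phi_next p p'.
have k1 : 1 <= (L / mu) ^+ 2.
  by rewrite -(expr1n _ 2) ler_pXn2r ?nnegrE ?divr_ge0 ?ler_pdivlMr ?mul1r// ltW.
have L1 : 0 < (24 * L)^-1 by rewrite invr_gt0 mulr_gt0.
have m1 : 0 < (2 * mu)^-1 by rewrite invr_gt0 mulr_gt0.
have c0 : 0 < L / mu ^+ 2 by rewrite divr_gt0// exprn_gt0.
have := dot_ge0 (p'.1 - p.1).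
move: h1 h2 h3; move: (dot (_ - _) _) (dot (grad _ _) _) (sqnorm_grad f p').
move: (sqnorm_grad _ _) hw (phi f p.1) (phi f p'.1) => g hw P P' dd G S h1 h2 h3 d0.
pose K := L / mu ^+ 2 * w.
have K0 : 0 <= K by rewrite mulr_ge0// ltW.
have e1 : G / (24 * L) <= K / 8 + L * dd / 2.
  have := ler_wpM2r (ltW L1) h3.
  have -> : (3 * ((L / mu) ^+ 2 * g) + 12 * (L ^+ 2 * dd)) / (24 * L)
    = L / mu ^+ 2 * g / 8 + L * dd / 2 by field; rewrite !gt_eqF.
  have := ler_wpM2l (ltW c0) hw; rewrite -/K.
  by move: (_ / (24 * L)) (L / mu ^+ 2 * g) => *; lra.
have e2 : g / (2 * mu) <= K / 2.
  rewrite invfM (mulrC 2^-1) mulrA ler_wpM2r ?invr_ge0//.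
  apply: (@le_trans _ _ (w / mu)); first by rewrite ler_wpM2r ?invr_ge0// ltW.
  have -> : K = w / mu * (L / mu) by rewrite /K; field; rewrite gt_eqF.
  by rewrite ler_peMr ?divr_ge0 ?ler_pdivlMr ?mul1r// ltW.
have a1 : a' <= 1 / 504 by apply: le_trans ha; rewrite ler_peMr.
have e3 : L / mu ^+ 2 * (a' * S) <= K / 126 + L * dd / 63.
  have q0 : 0 <= L / mu ^+ 2 * a' by rewrite mulr_ge0// ltW.
  have := ler_wpM2l q0 h2.
  have -> : L / mu ^+ 2 * a' * (2 * g + 8 * (L ^+ 2 * dd))
     = 2 * (a' * (L / mu ^+ 2 * g)) + 8 * (a' * (L / mu) ^+ 2 * (L * dd)).
    by field; rewrite !gt_eqF.
  have := ler_wpM2r (mulr_ge0 (ltW L0) d0) ha.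
  have := ler_wpM2l a0 (ler_wpM2l (ltW c0) hw); rewrite -/K.
  have := ler_wpM2r K0 a1.
  rewrite [L / mu ^+ 2 * (a' * S)]mulrA; move: (L / mu ^+ 2 * a' * S) (a' * (L / mu ^+ 2 * g)).
  by move: (a' * (L / mu) ^+ 2 * (L * dd)) (a' * K) (L * dd) => *; lra.
rewrite -/K; have := mulr_ge0 (ltW L0) d0.
move: e1 e2 e3 h1 K0; move: (G / _) (g / _) (L / mu ^+ 2 * (a' * S)) K (L * dd).
by move=> *; lra.
Qed.

(** The gradient at p is compared with that at (p.1, ystar), whose x part
    is the gradient of the envelope and whose y part vanishes. *)
Lemma initial_gradient p ystar : has_lbound (range (phi f)) ->
  is_argmax (f p.1) ystar ->
  sqnorm_grad f p <= 8 * (L ^+ 2 / mu) * (phi f p.1 - inf (range (phi f)))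
                     + 3 * L ^+ 2 * norm2 (p.2 - ystar) ^+ 2.
Proof.
move=> hb /(argmax_grady obj) y0; have := grad_phi_le obj p.1 hb.
rewrite (grad_phi obj y0); have [_ _ [_ _ hx hy] _] := obj.
have := hx p.1 p.2 p.1 ystar; have := hy p.1 p.2 p.1 ystar.
rewrite y0 subr0 subrr norm20 add0r => h1 h2 h3.
have h1' : norm2 (grady f p.1 p.2) ^+ 2 <= (L * norm2 (p.2 - ystar)) ^+ 2.
  by rewrite ler_pXn2r// nnegrE ?norm2_ge0// (le_trans (norm2_ge0 _) h1).
have h2' : norm2 (gradx f p.1 p.2 - gradx f p.1 ystar) ^+ 2
           <= (L * norm2 (p.2 - ystar)) ^+ 2.
  by rewrite ler_pXn2r// nnegrE ?norm2_ge0// (le_trans (norm2_ge0 _) h1).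
have := dot_sqrD (gradx f p.1 p.2 - gradx f p.1 ystar) (gradx f p.1 ystar).
rewrite subrK /sqnorm_grad -!sqr_norm2 in h3 *.
move: h1' h2' h3; rewrite exprMn.
move: (norm2 (grady f p.1 p.2) ^+ 2) (norm2 (gradx f p.1 p.2) ^+ 2).
move: (norm2 (gradx f p.1 ystar) ^+ 2) (norm2 (gradx f p.1 p.2 - gradx f p.1 ystar) ^+ 2).
move: (norm2 (p.2 - ystar) ^+ 2) (phi f p.1 - inf (range (phi f))) (L ^+ 2 / mu).
by move=> *; lra.
Qed.

Lemma sum_grad_phi (P : nat -> 'rV[R]_d1 * 'rV[R]_d2) (alpha : nat -> R) T :
  has_lbound (range (phi f)) -> (forall t, 0 <= alpha t) ->
  (forall t, alpha t.+1 * (L / mu) ^+ 2 <= 1 / 504) ->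
  (forall t, (t < T)%N -> sqnorm_grad (fhat f L (P t).1) (P t.+1)
                       <= alpha t * sqnorm_grad f (P t)) ->
  \sum_(1 <= t < T.+1) norm2 (grad (phi f) (P t).1) ^+ 2
   <= 24 * L * (phi f (P 0%N).1 - inf (range (phi f))
                + L / mu ^+ 2 * (alpha 0%N * sqnorm_grad f (P 0%N))).
Proof.
move=> hb a0 ha hP.
have sq0 p : 0 <= sqnorm_grad f p by rewrite addr_ge0 ?sqr_ge0.
have key n : (n <= T)%N ->
   (\sum_(1 <= t < n.+1) norm2 (grad (phi f) (P t).1) ^+ 2) / (24 * L)
   + (phi f (P n).1 + L / mu ^+ 2 * (alpha n * sqnorm_grad f (P n)))
   <= phi f (P 0%N).1 + L / mu ^+ 2 * (alpha 0%N * sqnorm_grad f (P 0%N)).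
  elim: n => [_|n IH nT]; first by rewrite big_geq// mul0r add0r.
  apply: le_trans (IH (ltnW nT)); rewrite big_nat_recr//= mulrDl -addrA lerD2l.
  rewrite sqr_norm2; apply: potential_descent; [exact: ha|exact: a0| |exact: hP].
  by rewrite mulr_ge0.
have hi : inf (range (phi f)) <= phi f (P T).1 by apply: (ge_inf hb); exists (P T).1.
have q0 : 0 <= L / mu ^+ 2 * (alpha T * sqnorm_grad f (P T)).
  by rewrite !mulr_ge0// ?invr_ge0 ?exprn_ge0// ltW.
have L24 : 0 < 24 * L by rewrite mulr_gt0.
rewrite mulrC -ler_pdivrMr//; have := key T (leqnn T); move: hi q0.
move: (_ / (24 * L)) (phi f (P T).1) (phi f (P 0%N).1) (inf _).
by move: (L / mu ^+ 2 * (alpha T * _)) (L / mu ^+ 2 * (alpha 0%N * _)) => *; lra.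
Qed.

End Outer.

(** * Stopping times and existence of the run *)

Lemma first_from_le m P n j : first_from m P n -> (m <= j)%N -> P j -> (n <= j)%N.
Proof.
move=> [_ _ h] mj Pj; rewrite leqNgt; apply/negP => jn.
by apply: (h j) => //; rewrite mj.
Qed.

Lemma first_from_exists m (P : nat -> Prop) j : (m <= j)%N -> P j ->
  exists n, first_from m P n.
Proof.
move=> mj Pj.
have ex : exists n, (m <= n)%N && `[< P n >] by exists j; rewrite mj; apply/asboolP.
case: (ex_minnP ex) => n /andP[mn /asboolP Pn] hn; exists n; split=> // i /andP[mi ilt] Pi.
by have := hn i; rewrite mi asboolT// => /(_ isT); rewrite leqNgt ilt.
Qed.

(** From 1 - r <= exp (- r), a number x / r of steps at rate 1 - r divides by
    exp x. *)
Lemma geometric_stop (R : realType) (r A x : R) : 0 < r < 1 -> 0 <= x ->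
  0 <= A -> A <= expR x ->
  exists2 N : nat, N%:R <= x / r + 1 & (0 < N)%N /\ A * (1 - r) ^+ N <= 1.
Proof.
move=> /andP[r0 r1] x0 A0 hA; have xr0 : 0 <= x / r by rewrite divr_ge0// ltW.
exists (Num.truncn (x / r)).+1.
  by rewrite -natr1 lerD2r truncn_le.
split=> //; have := truncnS_gt (x / r); move: (_.+1) => N hN.
have h1 : (1 - r) ^+ N <= expR (- x).
  apply: (@le_trans _ _ (expR (- r) ^+ N)).
    have r1' : 0 <= 1 - r by rewrite subr_ge0 ltW.
    by rewrite lerXn2r ?nnegrE ?expR_ge0 ?expR_ge1Dx.
  rewrite -expRM_natl ler_expR mulrN lerN2 -ler_pdivrMr//; exact: ltW.
apply: le_trans (ler_pM A0 _ hA h1) _.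
  by rewrite exprn_ge0// subr_ge0 ltW.
by rewrite -expRD subrr expR0.
Qed.

Section Run.
Context {R : realType} {d1 d2 : nat}.
Variables (f : 'rV[R]_d1 -> 'rV[R]_d2 -> R) (L mu s theta : R).
Hypothesis obj : nc_sc L mu f.
Hypotheses (sI : 0 < s < 1) (hs : s ^+ 2 * L = mu) (thetaI : 0 < theta <= 1 / 8).
Variable M : solver.

Let mu0 : 0 < mu. Proof. by case: obj. Qed.
Let muL : mu < L. Proof. by case: obj. Qed.
Let L0 : 0 < L. Proof. exact: lt_trans muL. Qed.
Let s0 : 0 < s. Proof. by case/andP: sI. Qed.
Let s1 : s < 1. Proof. by case/andP: sI. Qed.

Let eta := theta / (3 * L).

Definition solver_const := 8 / (theta / 3) ^+ 2 + 8.

Lemma solver_stop xc pt zz K N :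
  prox_run f L mu s xc pt zz K ->
  solver_const * (10 ^+ 7 * (L / mu) ^+ 2) * (1 - theta / 3) ^+ N <= 1 ->
  sqnorm_grad (ftilde f L (L - mu) xc (zz K.+1))
    (solver_iter M (ftilde f L (L - mu) xc (zz K.+1)) eta (pt K) N)
  <= stage_tol f L mu s xc pt K.+1.
Proof.
move=> hr hN; have [ps [psx psy]] := saddle_fhat xc obj.
have := stage_warm_start obj sI hs psx psy hr (leqnn K).
have T0 : 0 <= stage_tol f L mu s xc pt K.+1.
  apply: le_trans (stage_tol_ge obj sI pt psx psy _).
  apply: mulr_ge0; first by rewrite divr_ge0// ltW.
  apply: mulr_ge0; last exact: (g0_ge0 obj pt psx psy).
  by rewrite exprn_ge0//; have := s1; lra.
set g := ftilde _ _ _ _ _; rewrite !sqnorm_gradE stack_solver_iter => hw.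
have t0 : 0 <= L - mu by rewrite subr_ge0 ltW.
have tL : L - mu <= L by have := mu0; lra.
have mono : strongly_monotone L (saddle_op g).
  have hy := concave_y_ftilde obj xc (zz K.+1) t0; rewrite addrC subrK in hy.
  exact: (saddle_monotone (convex_x_ftilde obj _ xc _) hy).
have lip := lipschitz_ftilde obj xc (zz K.+1) t0 tL.
have /andP[th0 th1] := thetaI.
have eta0 : 0 < eta by rewrite divr_gt0// mulr_gt0.
have etaL : eta * L = theta / 3 by rewrite /eta; field; rewrite gt_eqF.
have e4 : eta * (4 * L) <= 1 / 6 by rewrite mulrCA etaL; lra.
have L4 : L <= 4 * L by have := L0; lra.
apply: le_trans (solver_rate M (stack (pt K)) N L0 L4 eta0 e4 lip mono) _.
rewrite etaL -/solver_const.
have c0 : 0 <= solver_const * (1 - theta / 3) ^+ N.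
  apply: mulr_ge0; first by rewrite addr_ge0// divr_ge0 ?sqr_ge0.
  by rewrite exprn_ge0//; lra.
apply: le_trans (ler_wpM2l c0 hw) _.
have := ler_wpM2r T0 hN; rewrite mul1r; apply: le_trans.
by rewrite le_eqVlt; apply/orP; left; apply/eqP; ring.
Qed.

Lemma prox_run_widen xc pt zz K K' : (K' <= K)%N ->
  prox_run f L mu s xc pt zz K -> prox_run f L mu s xc pt zz K'.
Proof. by move=> le [z1 h]; split=> // k kK; apply: h; exact: leq_trans le. Qed.

Lemma stage_stop xc pt zz K alpha : prox_run f L mu s xc pt zz K -> 0 < alpha ->
  10 ^+ 5 * (L / mu) ^+ 2 / alpha * (1 - 9 / 10 * s) ^+ K <= 1 ->
  sqnorm_grad (fhat f L xc) (pt K) <= alpha * sqnorm_grad (fhat f L xc) (pt 0%N).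
Proof.
move=> hr a0 hK; have [ps [psx psy]] := saddle_fhat xc obj.
apply: le_trans (stage_decay_rel obj sI hs psx psy hr (leqnn K)) _.
rewrite mulrA mulrA ler_wpM2r ?addr_ge0 ?sqr_ge0//.
by move: hK; rewrite mulrAC ler_pdivrMr// mul1r.
Qed.

Let tol (p : 'rV[R]_d1 * 'rV[R]_d2) k := stage_tol f L mu s p.1 (fun=> p) k.

Let momentum : let q := mu / (mu + (L - mu)) in
  (Num.sqrt q - q) / (Num.sqrt q + q) = (1 - s) / (1 + s).
Proof.
have -> : mu / (mu + (L - mu)) = s ^+ 2.
  by rewrite addrC subrK -hs mulfK// gt_eqF.
by rewrite /= sqrtr_sqr ger0_norm ?ltW//; field; rewrite !gt_eqF// addr_gt0// exprn_gt0.
Qed.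

(** ** Bounds valid for every run *)

Section Bounds.
Variables (x0 : 'rV[R]_d1) (y0 : 'rV[R]_d2) (alpha : nat -> R) (T : nat).
Variable r : trace R d1 d2.
Hypothesis run : catalyst_run f x0 y0 L mu (L - mu) M eta alpha tol T r.

Lemma run_prox t : (t <= T)%N ->
  prox_run f L mu s (pt r t 0).1 (pt r t) (zz r t) (rounds r t).
Proof.
move=> tT; have [_ /(_ t tT)[z1 hk _ _]] := run; split=> // k kK.
have [[_ hsq _] hp hz] := hk k.+1 kK.
by rewrite hz momentum hp; split.
Qed.

Lemma run_rounds t K : (t <= T)%N -> 0 < alpha t -> (0 < K)%N ->
  10 ^+ 5 * (L / mu) ^+ 2 / alpha t * (1 - 9 / 10 * s) ^+ K <= 1 ->
  (rounds r t <= K)%N.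
Proof.
move=> tT a0 K0 hK; rewrite leqNgt; apply/negP => lt.
have hr := prox_run_widen (ltnW lt) (run_prox tT).
have [_ /(_ t tT)[_ _ hf _]] := run.
by have := first_from_le hf K0 (stage_stop hr a0 hK); rewrite leqNgt lt.
Qed.

Lemma run_iters t k N : (t <= T)%N -> (k < rounds r t)%N ->
  solver_const * (10 ^+ 7 * (L / mu) ^+ 2) * (1 - theta / 3) ^+ N <= 1 ->
  (iters r t k.+1 <= N)%N.
Proof.
move=> tT kK hN.
have hr := prox_run_widen (ltnW kK) (run_prox tT).
have [_ /(_ t tT)[_ /(_ k.+1 kK)[hf _ _] _ _]] := run.
exact: (first_from_le hf (leq0n N) (solver_stop hr hN)).
Qed.

Lemma run_evals K N : (forall t, 0 < alpha t) -> (0 < K)%N ->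
  (forall t, 10 ^+ 5 * (L / mu) ^+ 2 / alpha t * (1 - 9 / 10 * s) ^+ K <= 1) ->
  solver_const * (10 ^+ 7 * (L / mu) ^+ 2) * (1 - theta / 3) ^+ N <= 1 ->
  (grad_evals M T r <= T.+1 * (K * (2 * N).+1))%N.
Proof.
move=> a0 K0 hK hN; rewrite /grad_evals.
have hc n : (n <= N)%N -> (solver_cost M n <= (2 * N).+1)%N.
  by case: M => /= nN; rewrite ltnS ?leq_mul2l// (leq_trans nN)// leq_pmull.
rewrite -[X in (_ <= X * _)%N]subn0 -sum_nat_const_nat.
rewrite big_nat_cond [leqRHS]big_nat_cond; apply: leq_sum => t /andP[/andP[_ tT] _].
rewrite ltnS in tT; have hKt := run_rounds tT (a0 t) K0 (hK t).
apply: leq_trans (_ : rounds r t * (2 * N).+1 <= _)%N; last by rewrite leq_mul2r hKt orbT.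
rewrite -[X in (_ <= X * _)%N](subn1 (rounds r t).+1) -sum_nat_const_nat.
rewrite big_nat_cond [leqRHS]big_nat_cond.
apply: leq_sum => -[|k] /andP[/andP[// _ kK] _]; rewrite ltnS in kK.
by apply: hc; exact: run_iters tT kK hN.
Qed.

Lemma run_next t : (t < T)%N ->
  sqnorm_grad (fhat f L (pt r t 0).1) (pt r t.+1 0)
    <= alpha t * sqnorm_grad f (pt r t 0).
Proof.
move=> tT; have [_ /(_ t (ltnW tT))[_ _ [_ hf _] ->]] := run.
by move: hf; rewrite (sqnorm_fhat_center obj).
Qed.

End Bounds.

(** ** Construction of a run

    The loops are unfolded without a bound on the number of rounds, every index
    being the first one that passes its test; the previous estimates show that
    such indices exist. *)

Section Existence.
Variable alpha : nat -> R.
Hypotheses (alpha0 : forall t, 0 < alpha t).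
Variables (K N : nat).
Hypothesis K0 : (0 < K)%N.
Hypothesis hK : forall t,
  10 ^+ 5 * (L / mu) ^+ 2 / alpha t * (1 - 9 / 10 * s) ^+ K <= 1.
Hypothesis hN :
  solver_const * (10 ^+ 7 * (L / mu) ^+ 2) * (1 - theta / 3) ^+ N <= 1.

Definition first_index m P : nat := xget 0%N (first_from m P).

(** The state S is the pair of (x_(k-1), y_(k-1)) and z_k, in a stage started
    at p0. *)
Definition inner_iters (p0 : 'rV[R]_d1 * 'rV[R]_d2)
    (S : ('rV[R]_d1 * 'rV[R]_d2) * 'rV[R]_d2) k :=
  let g := ftilde f L (L - mu) p0.1 S.2 in
  first_index 0 (fun n => sqnorm_grad g (solver_iter M g eta S.1 n) <= tol p0 k).

Fixpoint inner p0 (k : nat) : ('rV[R]_d1 * 'rV[R]_d2) * 'rV[R]_d2 :=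
  if k is k'.+1 then
    let S := inner p0 k' in
    let p := solver_iter M (ftilde f L (L - mu) p0.1 S.2) eta S.1
               (inner_iters p0 S k) in
    (p, p.2 + (1 - s) / (1 + s) *: (p.2 - S.1.2))
  else (p0, p0.2).

Definition inner_rounds t p0 := first_index 1 (fun k =>
  sqnorm_grad (fhat f L p0.1) (inner p0 k).1
    <= alpha t * sqnorm_grad (fhat f L p0.1) p0).

Lemma first_indexP m j (P : nat -> Prop) : (m <= j)%N -> P j ->
  first_from m P (first_index m P).
Proof. by move=> mj Pj; apply: xgetPex; exact: first_from_exists mj Pj. Qed.

Lemma inner_itersP p0 k :
  prox_run f L mu s p0.1 (fun k => (inner p0 k).1) (fun k => (inner p0 k.-1).2) k ->
  let g := ftilde f L (L - mu) p0.1 (inner p0 k).2 in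
  first_from 0 (fun n => sqnorm_grad g (solver_iter M g eta (inner p0 k).1 n)
                           <= tol p0 k.+1)
    (inner_iters p0 (inner p0 k) k.+1).
Proof.
by move=> hr; apply: (@first_indexP 0 N) => //; exact: (solver_stop hr hN).
Qed.

Lemma inner_prox p0 k : prox_run f L mu s p0.1 (fun k => (inner p0 k).1)
  (fun k => (inner p0 k.-1).2) k.
Proof.
elim: k => [|k IH]; first by split.
split=> // j; rewrite ltnS leq_eqVlt => /predU1P[->|]; last by case: IH => _; apply.
by split=> //; case: (inner_itersP IH).
Qed.

Lemma inner_roundsP t p0 :
  first_from 1 (fun k => sqnorm_grad (fhat f L p0.1) (inner p0 k).1
    <= alpha t * sqnorm_grad (fhat f L p0.1) p0) (inner_rounds t p0).
Proof.
by apply: (@first_indexP 1 K) => //; exact: (stage_stop (inner_prox p0 K) (alpha0 t) (hK t)).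
Qed.

Fixpoint stage_start p0 (t : nat) : 'rV[R]_d1 * 'rV[R]_d2 :=
  if t is t'.+1 then
    (inner (stage_start p0 t') (inner_rounds t' (stage_start p0 t'))).1
  else p0.

Lemma run_exists x0 y0 T :
  exists r, catalyst_run f x0 y0 L mu (L - mu) M eta alpha tol T r.
Proof.
pose st := stage_start (x0, y0).
exists (Trace (fun t k => (inner (st t) k).1) (fun t k => (inner (st t) k.-1).2)
  (fun t k => inner_iters (st t) (inner (st t) k.-1) k)
  (fun t => inner_rounds t (st t))).
split=> // t _; split=> // [[|k]//= _|].
  by rewrite momentum; split=> //; apply: inner_itersP; exact: inner_prox.
exact: inner_roundsP.
Qed.

End Existence.

End Run.

(** * Logarithmic factors and the final count *)

Lemma le_expR_ln (R : realType) (x : R) : 0 < x -> x <= expR `|ln x|.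
Proof. by move=> x0; rewrite -[leLHS](@lnK _ x) ?posrE// ler_expR ler_norm. Qed.

Lemma inv_le_expR_ln (R : realType) (x : R) : 0 < x -> x^-1 <= expR `|ln x|.
Proof.
move=> x0; rewrite -normrN -lnV ?posrE//.
by apply: le_expR_ln; rewrite invr_gt0.
Qed.

Lemma exprn_le_expR (R : realType) (x y : R) n : 0 <= x -> x <= expR y ->
  x ^+ n <= expR (n%:R * y).
Proof. by move=> x0 xy; rewrite expRM_natl lerXn2r ?nnegrE ?expR_ge0. Qed.

Lemma exprn_le_max1 (R : realType) (x : R) i j : 0 <= x -> (i <= j)%N ->
  x ^+ i <= Num.max 1 (x ^+ j).
Proof.
move=> x0 ij; rewrite le_max; have [x1|x1] := leP x 1.
  by rewrite exprn_ile1.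
by rewrite ler_weXn2l ?orbT// ltW.
Qed.

Section Constants.
Context {R : realType}.
Variables (L mu : R).
Hypotheses (mu0 : 0 < mu) (muL : mu < L).

Let L0 : 0 < L. Proof. exact: lt_trans muL. Qed.
Let alpha := fun t : nat =>
  if t == 0%N then mu ^+ 5 / (576 * Num.max 1 (L ^+ 7))
  else mu ^+ 5 / (504 * L ^+ 5).
Let max0 : 0 < Num.max 1 (L ^+ 7). Proof. by rewrite lt_max ltr01. Qed.

Lemma alpha_gt0 t : 0 < alpha t.
Proof.
have c1 : 0 < 576 :> R by rewrite ltr0n.
have c2 : 0 < 504 :> R by rewrite ltr0n.
rewrite /alpha; case: (t == 0%N).
  exact: (divr_gt0 (exprn_gt0 5 mu0) (mulr_gt0 c1 max0)).
exact: (divr_gt0 (exprn_gt0 5 mu0) (mulr_gt0 c2 (exprn_gt0 5 L0))).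
Qed.

Lemma alphaS_le t : alpha t.+1 * (L / mu) ^+ 2 <= 1 / 504.
Proof.
rewrite /alpha /=.
have -> : mu ^+ 5 / (504 * L ^+ 5) * (L / mu) ^+ 2 = (mu / L) ^+ 3 * (1 / 504).
  by field; rewrite !gt_eqF.
have c : 0 <= 1 / 504 :> R by rewrite divr_ge0 ?ler0n ?ler01.
apply: ler_piMl c _; rewrite exprn_ile1 ?divr_ge0 ?(ltW mu0) ?(ltW L0)//.
by rewrite ler_pdivrMr// mul1r ltW.
Qed.

(** The number of rounds of a stage is governed by the logarithm of this ratio,
    a monomial in L, mu and kappa; the smallest alpha t is the
    one at t = 0. *)
Lemma stage_ratio_le t (Lam : R) : `|ln L| + `|ln mu| + `|ln (L / mu)| + 1 <= Lam ->
  10 ^+ 5 * (L / mu) ^+ 2 / alpha t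
    <= expR ((`|ln (10 ^+ 5 * 576 : R)| + 14) * Lam).
Proof.
move=> hLam.
have nL := normr_ge0 (ln L); have nm := normr_ge0 (ln mu).
have nk := normr_ge0 (ln (L / mu)).
have k0 : 0 < L / mu by rewrite divr_gt0.
have mi : 0 <= mu^-1 by rewrite invr_ge0 ltW.
have c1 : 0 < 10 ^+ 5 :> R by rewrite exprn_gt0 ?ltr0n.
have c2 : 0 < 576 :> R by rewrite ltr0n.
have c0 : 0 < 10 ^+ 5 * 576 :> R := mulr_gt0 c1 c2.
have hL : L <= expR Lam.
  by apply: le_trans (le_expR_ln L0) _; rewrite ler_expR; lra.
have hm : mu^-1 <= expR Lam.
  by apply: le_trans (inv_le_expR_ln mu0) _; rewrite ler_expR; lra.
have hk : L / mu <= expR Lam.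
  by apply: le_trans (le_expR_ln k0) _; rewrite ler_expR; lra.
have hM : Num.max 1 (L ^+ 7) <= expR (7 * Lam).
  rewrite ge_max (exprn_le_expR 7 (ltW L0) hL) andbT -[leLHS]expR0 ler_expR.
  by rewrite mulr_ge0 ?ler0n//; lra.
have hc : 10 ^+ 5 * 576 <= expR (`|ln (10 ^+ 5 * 576 : R)| * Lam).
  apply: le_trans (le_expR_ln c0) _; rewrite ler_expR ler_peMr//; lra.
apply: (@le_trans _ _ (10 ^+ 5 * 576 * (L / mu) ^+ 2 * Num.max 1 (L ^+ 7) * mu^-1 ^+ 5)).
  rewrite /alpha; case: ifP => _.
    rewrite le_eqVlt; apply/orP; left; apply/eqP; field.
    by rewrite !gt_eqF.
  have -> : 10 ^+ 5 * (L / mu) ^+ 2 / (mu ^+ 5 / (504 * L ^+ 5))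
     = 10 ^+ 5 * (504 * L ^+ 5) * (L / mu) ^+ 2 * mu^-1 ^+ 5.
    by field; rewrite !gt_eqF.
  apply: ler_wpM2r; first exact: exprn_ge0.
  rewrite [leRHS]mulrAC; apply: ler_wpM2r; first exact: sqr_ge0.
  rewrite -[leRHS]mulrA; apply: ler_wpM2l; first exact: ltW.
  apply: ler_pM; [exact: ler0n|exact: exprn_ge0 (ltW L0)|by rewrite ler_nat|].
  exact: exprn_le_max1 (ltW L0) _.
have -> : (`|ln (10 ^+ 5 * 576 : R)| + 14) * Lam
  = `|ln (10 ^+ 5 * 576 : R)| * Lam + 2%:R * Lam + 7 * Lam + 5%:R * Lam by ring.
rewrite !expRD; have := ltW c0; have := sqr_ge0 (L / mu).
have := exprn_le_expR 2 (ltW k0) hk; have := exprn_le_expR 5 mi hm.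
have := exprn_ge0 5 mi; have := ltW max0; move: hc hM.
move: (expR (7 * Lam)) (expR (5%:R * Lam)) (expR (2%:R * Lam)).
move: (expR (`|ln (10 ^+ 5 * 576 : R)| * Lam)).
move: (10 ^+ 5 * 576 : R) ((L / mu) ^+ 2) (Num.max 1 (L ^+ 7)) (mu^-1 ^+ 5).
move=> a b c d a' c' d' b' ha hc hc0 hd0 hd hb hb0 ha0.
by apply: ler_pM; rewrite ?mulr_ge0//; apply: ler_pM; rewrite ?mulr_ge0//; apply: ler_pM.
Qed.

(** The value of alpha at 0 is small enough for the initial gradient, whose square
    is of order L^2 Delta / mu + L^2 D, to enter only as L (Delta + D). *)
Lemma initial_potential (S Delta Dy : R) : 0 <= Delta -> 0 <= Dy ->
  S <= 8 * (L ^+ 2 / mu) * Delta + 3 * L ^+ 2 * Dy ->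
  L / mu ^+ 2 * (alpha 0%N * S) <= Delta + Dy.
Proof.
move=> D0 Y0 hS; rewrite /alpha /=; set Mx := Num.max 1 (L ^+ 7).
have c0 : 0 <= L / mu ^+ 2 * (mu ^+ 5 / (576 * Mx)).
  have c1 : 0 < 576 :> R by rewrite ltr0n.
  exact: ltW (mulr_gt0 (divr_gt0 L0 (exprn_gt0 2 mu0))
                (divr_gt0 (exprn_gt0 5 mu0) (mulr_gt0 c1 max0))).
rewrite mulrA; apply: le_trans (ler_wpM2l c0 hS) _.
have -> : L / mu ^+ 2 * (mu ^+ 5 / (576 * Mx))
      * (8 * (L ^+ 2 / mu) * Delta + 3 * L ^+ 2 * Dy)
  = 1 / 72 * (mu ^+ 2 * L ^+ 3 / Mx) * Delta
    + 1 / 192 * (mu ^+ 3 * L ^+ 3 / Mx) * Dy.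
  by field; rewrite !gt_eqF.
have p1 : mu ^+ 2 * L ^+ 3 / Mx <= 1.
  rewrite ler_pdivrMr// mul1r; apply: le_trans (exprn_le_max1 (i := 5) (ltW L0) _) => //.
  by rewrite (exprD L 2 3) ler_wpM2r ?exprn_ge0 ?lerXn2r ?nnegrE// ltW.
have p2 : mu ^+ 3 * L ^+ 3 / Mx <= 1.
  rewrite ler_pdivrMr// mul1r; apply: le_trans (exprn_le_max1 (i := 6) (ltW L0) _) => //.
  by rewrite (exprD L 3 3) ler_wpM2r ?exprn_ge0 ?lerXn2r ?nnegrE// ltW.
have := ler_wpM2r D0 p1; have := ler_wpM2r Y0 p2.
by move: (_ / Mx) (_ / Mx) => *; lra.
Qed.

End Constants.

Theorem mainTheorem4 (R : realType) (theta : R) (htheta : 0 < theta <= 1 / 8) :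
  exists (C : R) (m : nat), 0 < C /\
  forall (d1 d2 : nat) (f : 'rV[R]_d1 -> 'rV[R]_d2 -> R) (L mu : R)
    (x0 : 'rV[R]_d1) (y0 ystar : 'rV[R]_d2) (M : solver) (eps : R),
    0 < mu -> mu < L ->
    lipschitz_smooth L f ->
    (forall x, strongly_concave mu (f x)) ->
    has_lbound (range (phi f)) ->
    is_argmax (f x0) ystar ->
    0 < eps ->
    let kappa := L / mu in
    let Delta := phi f x0 - inf (range (phi f)) in
    let Dy := norm2 (y0 - ystar) ^+ 2 in
    let tau := L - mu in
    let q := mu / (mu + tau) in
    let rho := 9 / 10 * Num.sqrt q in
    let eta := theta / (L + Num.max (2 * L) tau) in
    let alpha := fun t : nat =>
      if t == 0%N then mu ^+ 5 / (576 * Num.max 1 (L ^+ 7))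
      else mu ^+ 5 / (504 * L ^+ 5) in
    let tol := fun (p : 'rV[R]_d1 * 'rV[R]_d2) (k : nat) =>
      Num.sqrt 2 * mu / 2 * (1 - rho) ^+ k * gap (fhat f L p.1) p in
    exists T : nat,
      [/\ (0 < T)%N,
          exists r : trace R d1 d2,
            catalyst_run f x0 y0 L mu tau M eta alpha tol T r
        & forall r : trace R d1 d2,
            catalyst_run f x0 y0 L mu tau M eta alpha tol T r ->
            stationary_in_mean (phi f) eps T (fun t => (pt r t 0).1) /\
            (grad_evals M T r)%:R
              <= C * (1 + `|ln L| + `|ln mu| + `|ln kappa|) ^+ m
                 * (Num.sqrt kappa
                    * Num.max 1 (L * (Delta + Dy) / eps ^+ 2))].
Proof.
have /andP[th0 th1] := htheta.
have r0 : 0 < theta / 3 < 1 by apply/andP; split; lra.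
set ca : R := `|ln (10 ^+ 5 * 576 : R)| + 14.
have Cs0 : 0 < solver_const theta :> R.
  by rewrite addr_gt0 ?ltr0n// divr_gt0 ?ltr0n// exprn_gt0//; lra.
have Cs7 : 0 < solver_const theta * 10 ^+ 7 :> R.
  by apply: mulr_gt0 Cs0 _; rewrite exprn_gt0 ?ltr0n.
set cb : R := (`|ln (solver_const theta * 10 ^+ 7 : R)| + 2) / (theta / 3).
have ca0 : 0 <= ca by rewrite addr_ge0 ?ler0n.
have cb0 : 0 <= cb.
  by rewrite divr_ge0 ?addr_ge0 ?ler0n//; lra.
exists (50 * ((2 * ca + 1) * (2 * cb + 3))), 2%N; split.
  by rewrite !mulr_gt0 ?ltr0n//; lra.
move=> d1 d2 f L mu x0 y0 ystar M eps mu0 muL hf hc hb hy eps0.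
move=> kappa Delta Dy tau q rho eta alpha tol.
have obj : nc_sc L mu f by split.
have L0 : 0 < L by exact: lt_trans muL.
have k0 : 0 < kappa by rewrite divr_gt0.
have qE : q = mu / L by rewrite /q /tau addrC subrK.
pose s := Num.sqrt q.
have q0 : 0 < q by rewrite qE divr_gt0.
have s0 : 0 < s by rewrite sqrtr_gt0.
have s2 : s ^+ 2 = mu / L by rewrite sqr_sqrtr ?ltW.
have hs : s ^+ 2 * L = mu by rewrite s2 divfK// gt_eqF.
have s1 : s < 1.
  by rewrite /s -[ltRHS]sqrtr1 ltr_sqrt ?ltr01// qE ltr_pdivrMr// mul1r.
have sI : 0 < s < 1 by rewrite s0 s1.
have sk : s^-1 = Num.sqrt kappa by rewrite /s qE -sqrtrV ?invf_div// divr_ge0// ltW.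
have etaE : eta = theta / (3 * L).
  have -> : eta = theta / (L + 2 * L).
    by rewrite /eta max_l// /tau; move: L0 mu0; lra.
  by congr (_ / _); ring.
set Lam := 1 + `|ln L| + `|ln mu| + `|ln kappa|.
have Lam1 : 1 <= Lam.
  rewrite /Lam; have := normr_ge0 (ln L); have := normr_ge0 (ln mu).
  by have := normr_ge0 (ln kappa); lra.
have hLam : `|ln L| + `|ln mu| + `|ln (L / mu)| + 1 <= Lam by rewrite /Lam -/kappa; lra.
have rI : 0 < 9 / 10 * s < 1 by apply/andP; split; lra.
have a0 t : 0 < alpha t := alpha_gt0 mu0 muL t.
have Lam0 : 0 <= Lam by lra.
(* K and N are the common bounds on the rounds of a stage and on the iterations
   of a round. *)
have [K hK [K0 hKs]] : exists2 K : nat, K%:R <= ca * Lam / (9 / 10 * s) + 1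
   & (0 < K)%N /\ expR (ca * Lam) * (1 - 9 / 10 * s) ^+ K <= 1.
  by apply: geometric_stop rI _ (expR_ge0 _) (lexx _); rewrite mulr_ge0.
have hKt t : 10 ^+ 5 * (L / mu) ^+ 2 / alpha t * (1 - 9 / 10 * s) ^+ K <= 1.
  apply: le_trans hKs; apply: ler_wpM2r; first by rewrite exprn_ge0//; lra.
  exact: (stage_ratio_le mu0 muL t hLam).
have [N hN [_ hNs]] : exists2 N : nat, N%:R <= cb * Lam + 1 & (0 < N)%N /\
    solver_const theta * (10 ^+ 7 * (L / mu) ^+ 2) * (1 - theta / 3) ^+ N <= 1.
  have -> : cb * Lam
      = (`|ln (solver_const theta * 10 ^+ 7 : R)| * Lam + 2%:R * Lam) / (theta / 3).
    by rewrite /cb; field; rewrite gt_eqF.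
  apply: geometric_stop r0 _ _ _.
  - by rewrite addr_ge0 ?mulr_ge0.
  - by rewrite mulrA mulr_ge0 ?sqr_ge0// ltW.
  rewrite mulrA expRD; apply: ler_pM; [exact: ltW|exact: sqr_ge0| |].
    by apply: le_trans (le_expR_ln Cs7) _; rewrite ler_expR ler_peMr.
  apply: exprn_le_expR; first exact: ltW.
  apply: le_trans (le_expR_ln k0) _; rewrite ler_expR -/kappa; move: hLam; rewrite -/kappa.
  by have := normr_ge0 (ln L); have := normr_ge0 (ln mu); lra.
pose X := L * (Delta + Dy) / eps ^+ 2.
have D0 : 0 <= Delta by rewrite subr_ge0; apply: (ge_inf hb); exists x0.
have Dy0 : 0 <= Dy by rewrite sqr_ge0.
have e20 : 0 < eps ^+ 2 by rewrite exprn_gt0.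
have X0 : 0 <= X := divr_ge0 (mulr_ge0 (ltW L0) (addr_ge0 D0 Dy0)) (ltW e20).
have X48 : 0 <= 48 * X by rewrite mulr_ge0 ?ler0n.
(* The sum of the squared gradients is at most 48 L (Delta + Dy). *)
exists (Num.truncn (48 * X)).+1.
set T := (Num.truncn (48 * X)).+1.
have runE r : catalyst_run f x0 y0 L mu tau M eta alpha tol T r <->
   catalyst_run f x0 y0 L mu (L - mu) M (theta / (3 * L)) alpha
     (fun p k => stage_tol f L mu s p.1 (fun=> p) k) T r by rewrite etaE.
split=> //.
  have [r hr] := run_exists obj sI hs htheta M a0 K0 hKt hNs x0 y0 T.
  by exists r; apply/runE.
move=> r /runE hr; split.
  split=> [t _|]; first exact: (phi_differentiable obj).
  rewrite /unif_mean.
  have := sum_grad_phi (P := fun t => pt r t 0) obj hb (fun t => ltW (a0 t))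
    (alphaS_le mu0 muL) (fun t tT => run_next obj hr tT).
  have [p00 _] := hr; rewrite p00 /= -/Delta.
  have := initial_potential mu0 muL D0 Dy0 (initial_gradient (p := (x0, y0)) obj hb hy).
  rewrite -/(alpha 0%N) /= => hI hS.
  rewrite ler_pdivrMl ?ltr0n//; apply: le_trans hS _.
  apply: (@le_trans _ _ (48 * X * eps ^+ 2)).
    have -> : 48 * X * eps ^+ 2 = 24 * L * (2 * (Delta + Dy)).
      by rewrite /X; field; rewrite gt_eqF.
    apply: ler_wpM2l; first by rewrite mulr_ge0 ?ler0n// ltW.
    move: hI D0 Dy0; clear; move: (L / _ * _) Delta Dy => *; lra.
  by apply: ler_wpM2r; [exact: ltW | exact: ltW (truncnS_gt _)].
have := run_evals obj sI hs htheta hr a0 K0 hKt hNs.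
rewrite -(ler_nat R) !natrM => /le_trans; apply.
have u1 : 1 <= Num.sqrt kappa * Lam.
  rewrite -sk -[leLHS]mulr1; apply: ler_pM => //.
  by rewrite -[leLHS]invr1 lef_pV2 ?posrE// ltW.
have hT : T.+1%:R <= 50 * Num.max 1 X.
  have h1 : (Num.truncn (48 * X))%:R <= 48 * X by rewrite truncn_le.
  have h2 : 1 <= Num.max 1 X by rewrite le_max lexx.
  have h3 : X <= Num.max 1 X by rewrite le_max lexx orbT.
  rewrite /T -natr1 -natr1; move: h1 h2 h3; clear.
  by move: X (Num.max 1 X) (Num.truncn _)%:R => *; lra.
have hK' : K%:R <= (2 * ca + 1) * (Num.sqrt kappa * Lam).
  apply: le_trans hK _.
  have -> : ca * Lam / (9 / 10 * s) = 10 / 9 * (ca * (Num.sqrt kappa * Lam)).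
    by rewrite -sk; field; rewrite gt_eqF.
  have := ler_wpM2l ca0 u1; move: ca0 u1; clear.
  by move: (Num.sqrt kappa * Lam) ca => u c c0 u1; rewrite mulr1; lra.
have hN' : (2 * N).+1%:R <= (2 * cb + 3) * Lam.
  rewrite -natr1 natrM; move: hN Lam1; clear.
  by move: N%:R Lam cb => *; lra.
apply: le_trans (ler_pM _ _ hT (ler_pM _ _ hK' hN')) _; rewrite ?mulr_ge0 ?ler0n//.
rewrite le_eqVlt; apply/orP; left; apply/eqP; rewrite -/Lam; ring.
Qed.
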